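(* Let $\sigma,\kappa>0$ and $\kappa_c:=4\sigma^4$. If $\kappa<\kappa_c$, then the uniform stationary Nash equilibrium, i.e. the constant flow $p(t)\equiv1/2$ (equivalently $q\equiv 0$ with $q=2p-1$), is the unique ergodic Nash equilibrium.
   Context: Let $\mathcal{X}=\{0,1\}$. The running cost is $\ell(0,p)=p$, $\ell(1,p)=1-p$ for $p\in[0,1]$. A probability measure on $\mathcal{X}$ is identified with the mass $p$ it gives to $1$. $\mathcal{A}$ is the set of functions $\alpha:[0,\infty)\times\mathcal{X}\to[0,\infty)$ with $\alpha(\cdot,x)$ locally integrable. For a flow $p:[0,\infty)\to[0,1]$ and $\alpha\in\mathcal{A}$, $X^{\alpha}$ is the continuous-time Markov chain on $\mathcal{X}$ with jump rate $\sigma^2+\alpha(t,0)$ from $0$ to $1$, jump rate $\sigma^2+\alpha(t,1)$ from $1$ to $0$, and $\mathbb{P}(X^{\alpha}_0=1)=p(0)$, and $$J_0(\alpha)=\limsup_{T\uparrow\infty}\frac1T\mathbb{E}\int_0^T\big(\tfrac12\alpha(t,X^{\alpha}_t)^2+\kappa\ell(X^{\alpha}_t,p(t))\big)dt .$$ A periodic or constant flow $p$ is an ergodic mean-field game Nash equilibrium if there is $\alpha^*\in\mathcal{A}$ minimizing $J_0$ over $\mathcal{A}$ with $p(t)=\mathbb{P}(X^{\alpha^*}_t=1)$ for all $t\ge0$. (By definition, ergodic Nash equilibria are always periodic or constant flows.) *)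

(* Defs.v *)
From HB Require Import structures.
From mathcomp Require Import all_boot all_order all_algebra.
From mathcomp Require Import all_classical all_reals all_analysis.
Set Implicit Arguments.
Unset Strict Implicit.
Unset Printing Implicit Defensive.
Import Order.TTheory GRing.Theory Num.Theory.
Import numFieldNormedType.Exports.
Local Open Scope classical_set_scope.
Local Open Scope ring_scope.

(* The state space {0, 1} is [bool], with [true] for the state 1.  Functions of
   time are total on [R]; only their values on [0, +oo[ are ever used. *)

Definition running_cost (R : realType) (x : bool) (p : R) : R :=
  if x then 1 - p else p.

Definition critical_coupling (R : realType) (sigma : R) : R :=
  4 * sigma ^+ 4.

Definition admissible (R : realType) (alpha : R -> bool -> R) : Prop :=
  (forall t x, 0 <= t -> 0 <= alpha t x) /\
  (forall T x, 0 <= T ->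
    (@lebesgue_measure R).-integrable `[0, T] (EFin \o alpha ^~ x)).

(* [jump_rate sigma alpha t x] is the rate of leaving [x] at time [t]. *)
Definition jump_rate (R : realType) (sigma : R) (alpha : R -> bool -> R)
    (t : R) (x : bool) : R :=
  sigma ^+ 2 + alpha t x.

Section chain.
Context (R : realType) (d : measure_display) (Omega : measurableType d)
  (P : probability Omega R).
Implicit Type Y : R -> {RV P >-> bool}.

Definition cadlag Y : Prop := forall w,
  (forall t, 0 <= t -> \forall s \near t^'+, Y s w = Y t w) /\
  (forall t, 0 < t -> exists x, \forall s \near t^'-, Y s w = x).

Definition past Y (s : R) : set (set Omega) :=
  <<s \bigcup_(r in `[0, s]) preimage_set_system setT (Y r) measurable >>.

(* P(A, Y_t = y | Y_s = x) = P(A | Y_s = x) P(Y_t = y | Y_s = x) for A in the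
   past of s, with denominators cleared. *)
Definition markov_property Y : Prop :=
  forall (s t : R) (A : set Omega) (x y : bool),
    0 <= s -> s <= t -> past Y s A ->
    (P (A `&` (Y s @^-1` [set x]) `&` (Y t @^-1` [set y]))
       * P (Y s @^-1` [set x]) =
     P (A `&` (Y s @^-1` [set x]))
       * P ((Y s @^-1` [set x]) `&` (Y t @^-1` [set y])))%E.

Definition joint Y (s : R) (x : bool) (t : R) (y : bool) : R :=
  fine (P ((Y s @^-1` [set x]) `&` (Y t @^-1` [set y]))).

(* [rate t x] is the rate of jumping from [x] to [~~ x] at time [t].  As the
   rates are only locally integrable in time,
   P(Y_(t+h) = ~~ x | Y_t = x) = rate t x * h + o(h) makes sense for almost
   every t only, so it is taken in its integrated form: the transition
   probabilities P(Y_t = y | Y_s = x) satisfy Kolmogorov's forward equation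
   (here multiplied by P(Y_s = x)). *)
Definition has_jump_rate (rate : R -> bool -> R) Y : Prop :=
  forall (s t : R) (x y : bool), 0 <= s -> s <= t ->
    joint Y s x t y = joint Y s x s y +
      \int[lebesgue_measure]_(r in `[s, t])
        (rate r (~~ y) * joint Y s x r (~~ y) - rate r y * joint Y s x r y).

Definition jump_chain (rate : R -> bool -> R) (p0 : R) Y : Prop :=
  [/\ cadlag Y, markov_property Y, has_jump_rate rate Y
    & P (Y 0 @^-1` [set true]) = p0%:E].

(* Extended-real valued: [alpha] need not be locally square integrable. *)
Definition ergodic_cost (kappa : R) (p : R -> R) (alpha : R -> bool -> R) Y
    : \bar R :=
  limf_esup (fun T : R => (T^-1)%R%:E *
    \int[P]_w \int[lebesgue_measure]_(t in `[0%R, T])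
      (2^-1 * alpha t (Y t w) ^+ 2 + kappa * running_cost (Y t w) (p t))%R%:E)%E
    +oo%R.

Definition flow (p : R -> R) : Prop := forall t, 0 <= t -> 0 <= p t <= 1.

Definition constant_flow (p : R -> R) : Prop :=
  exists c, forall t, 0 <= t -> p t = c.

Definition periodic_flow (p : R -> R) : Prop :=
  exists2 tau, 0 < tau & forall t, 0 <= t -> p (t + tau) = p t.

(* A choice, on one probability space, of the chain X^alpha for every
   admissible control [alpha] and every initial mass [p0] of the state 1. *)
Definition controlled_chains (sigma : R)
    (X : (R -> bool -> R) -> R -> R -> {RV P >-> bool}) : Prop :=
  forall alpha p0, admissible alpha -> 0 <= p0 <= 1 ->
    jump_chain (jump_rate sigma alpha) p0 (X alpha p0).

Definition ergodic_nash (kappa : R)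
    (X : (R -> bool -> R) -> R -> R -> {RV P >-> bool}) (p : R -> R) : Prop :=
  [/\ flow p, periodic_flow p \/ constant_flow p &
    exists alpha, [/\ admissible alpha,
      forall beta, admissible beta ->
        (ergodic_cost kappa p alpha (X alpha (p 0%R)) <=
         ergodic_cost kappa p beta (X beta (p 0%R)))%E
      & forall t, 0 <= t ->
          P (X alpha (p 0) t @^-1` [set true]) = (p t)%:E]].

End chain.

(* Main.v *)
Require Import Defs.
From mathcomp Require Import all_boot all_order all_algebra.
From mathcomp Require Import all_classical all_reals all_analysis.
From mathcomp Require Import measurable_realfun ring lra.
Set Implicit Arguments.
Unset Strict Implicit.
Unset Printing Implicit Defensive.
Import Order.TTheory GRing.Theory Num.Theory.
Import numFieldNormedType.Exports.
Local Open Scope classical_set_scope.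
Local Open Scope ring_scope.

(** Write [q = 2 p - 1] and [s = sigma ^+ 2].  The law [m] of a controlled chain
    solves the linear equation [m' = (s + alpha_0) (1 - m) - (s + alpha_1) m], and
    its expected cost up to [T] is the integral over [0, T] of
    [(alpha_0^2 (1 - m) + alpha_1^2 m) / 2 + kappa ((1 - m) p + m (1 - p))]
    ([mass_primitive], [expected_cost]).  So an equilibrium is a solution of a
    deterministic control problem.  Against the flow [1/2] the running cost is
    [kappa / 2] in both states: not acting is optimal, and the uncontrolled chain
    started from [1/2] stays there ([uniform_nash]).

    For uniqueness the Hamilton-Jacobi-Bellman equation is avoided; one well-chosen
    competitor is enough.  In the fluxes [alpha_0 (1 - m)] and [alpha_1 m] the
    problem has a linear dynamics and a convex control cost, so the optimal
    trajectory [p] may be mixed, with weights [1 - e] and [e], with the uncontrolled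
    trajectory [g] that has the same initial value.  The fluxes of the mixture are
    [1 - e] times those of [p], and the control that realises them never exceeds
    [alpha] ([mixed_control]).

    Since [g] tends to [1/2] exponentially fast, to first order in [e] the mixture
    loses [kappa q^2 / 2] in the running cost per unit of time.  It saves at least
    [r^2 / 2] in the control cost, where [r = 2 alpha_0 (1 - p)] when [q >= 0] and
    [r = 2 alpha_1 p] when [q < 0] ([mix_flux_gain]).  Only the flux that pushes [q]
    away from [0] is counted here, and it is also the only one that can make
    [q (q' + 2 s q) = 2 q (alpha_0 (1 - p) - alpha_1 p)] positive.  Hence
    [r |q| >= q q' + 2 s q^2].  As [q] is bounded, [q q'] averages to [0], so
    [r^2 / 2 >= 2 s r |q| - 2 s^2 q^2] is on average at least [2 s^2 q^2].  The
    mixture therefore gains about [e (2 s^2 - kappa / 2) q^2] on average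
    ([mean_cost_gain]), which is positive exactly below the critical coupling
    [4 s^2].  A periodic flow with [q] not identically [0] has a positive mean of
    [q^2] ([periodic_sqr_growth]), so it is not optimal against itself.

    The controls are only locally integrable, so everything about [q] is derived from
    its integral equation.  The one tool is the chain rule for [q^2]
    ([primitive_sqr]), which also gives uniqueness of the law ([drift_unique]). *)

(** * Primitives of integrable functions *)

Section primitives.
Context {R : realType}.
Local Notation mu := (@lebesgue_measure R).
Implicit Types (f g q : R -> R) (s t T : R).

Definition primitive_on T f q :=
  forall t, 0 <= t <= T -> q t = q 0 + \int[mu]_(r in `[0, t]) f r.

Lemma integrable_subset_itv f T (A : set R) : measurable A ->
  A `<=` `[0, T] -> mu.-integrable `[0, T] (EFin \o f) ->
  mu.-integrable A (EFin \o f).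
Proof. by move=> mA sA; apply: integrableS. Qed.

Lemma itv_oc_sub0 s t T : 0 <= s -> t <= T -> `]s, t] `<=` `[0, T].
Proof.
move=> s0 tT x /=; rewrite !in_itv /= => /andP[sx xt].
by rewrite (ltW (le_lt_trans s0 sx)) (le_trans xt tT).
Qed.

Lemma Rintegral_itv_split f s t T : 0 <= s -> s <= t -> t <= T ->
  mu.-integrable `[0, T] (EFin \o f) ->
  \int[mu]_(r in `[0, t]) f r =
  \int[mu]_(r in `[0, s]) f r + \int[mu]_(r in `]s, t]) f r.
Proof.
move=> s0 st tT fi.
have -> : \int[mu]_(r in `]s, t]) f r =
   \int[mu]_(r in `[0, t]) f r - \int[mu]_(r in `[0, s]) f r.
  rewrite Rintegral_itvB//.
  by apply: integrable_subset_itv fi => //; apply: subset_itvl; rewrite bnd_simp.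
by rewrite addrC subrK.
Qed.

Lemma primitive_increment T f q s t : mu.-integrable `[0, T] (EFin \o f) ->
  primitive_on T f q -> 0 <= s -> s <= t -> t <= T ->
  q t - q s = \int[mu]_(r in `]s, t]) f r.
Proof.
move=> fi qf s0 st tT.
rewrite (qf t) ?(le_trans s0 st)// (qf s) ?s0 ?(le_trans st tT)//.
by rewrite (Rintegral_itv_split s0 st tT fi); ring.
Qed.

(** Uniform continuity, in the form of absolute continuity of the integral: it serves
    both as the modulus of continuity in the chain rule for [q ^+ 2] and as the
    continuity of [q] at a point. *)
Lemma primitive_modulus T f q : mu.-integrable `[0, T] (EFin \o f) ->
  primitive_on T f q -> forall e, 0 < e ->
  exists2 h, 0 < h & forall s t, 0 <= s -> s <= t -> t <= T -> t - s < h ->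
    `|q t - q s| < e.
Proof.
move=> fi qf e e0.
have fi' : mu.-integrable setT (EFin \o (f \_ `[0, T])).
  by rewrite -restrict_EFin; apply/integrable_restrict => //=; rewrite setTI.
have [h [h0 fh]] := integral_normr_continuous fi' e0.
exists h => // s t s0 st tT tsh.
rewrite (primitive_increment fi qf)//.
have sub := itv_oc_sub0 s0 tT.
have ist : mu.-integrable `]s, t] (EFin \o f) by exact: integrable_subset_itv fi.
apply: le_lt_trans (le_normr_Rintegral _ ist) _ => //.
rewrite [ltLHS](_ : _ = \int[mu]_(x in `]s, t]) `|(f \_ `[0, T]) x|).
  apply: fh => //.
  by rewrite /= lebesgue_measure_itv /= lte_fin; case: ifPn => // _; rewrite -?EFinD lte_fin.
apply: eq_Rintegral => x; rewrite inE => xst; rewrite patchE ifT// inE.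
exact: sub.
Qed.

Lemma primitive_measurable T f q : 0 <= T -> mu.-integrable `[0, T] (EFin \o f) ->
  primitive_on T f q -> measurable_fun `[0, T] q.
Proof.
move=> T0 fi qf.
apply: (@eq_measurable_fun _ _ _ _ _ (fun t => q 0 + parameterized_integral mu 0 t f)).
  by move=> t; rewrite inE/= in_itv/= => t0T; rewrite -qf.
apply: measurable_funD => //.
apply: subspace_continuous_measurable_fun => //.
exact: parameterized_integral_continuous.
Qed.

Lemma integrable_mul_bounded (A : set R) f g M : measurable A ->
  mu.-integrable A (EFin \o f) -> measurable_fun A g ->
  (forall x, A x -> `|g x| <= M) ->
  mu.-integrable A (EFin \o (fun x => f x * g x)).
Proof.
move=> mA fi mg gM.
rewrite (_ : EFin \o _ = ((EFin \o f) \* (EFin \o g))%E); last first.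
  by apply/funext => x /=; rewrite EFinM.
apply: integrableMl => //.
exists M; split; first exact: num_real.
by move=> N MN x Ax; apply: le_trans (gM x Ax) (ltW MN).
Qed.

Lemma integrable_scale T f (c : R) : mu.-integrable `[0, T] (EFin \o f) ->
  mu.-integrable `[0, T] (EFin \o (fun x => c * f x)).
Proof. by move=> fi; exact: (integrableZl _ c fi). Qed.

Lemma integrable_add T f g : mu.-integrable `[0, T] (EFin \o f) ->
  mu.-integrable `[0, T] (EFin \o g) ->
  mu.-integrable `[0, T] (EFin \o (fun x => f x + g x)).
Proof. by move=> fi gi; exact: (integrableD _ fi gi). Qed.

Lemma integrable_sub T f g : mu.-integrable `[0, T] (EFin \o f) ->
  mu.-integrable `[0, T] (EFin \o g) ->
  mu.-integrable `[0, T] (EFin \o (fun x => f x - g x)).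
Proof. by move=> fi gi; exact: (integrableB _ fi gi). Qed.

Lemma primitive_bounded T f q : mu.-integrable `[0, T] (EFin \o f) ->
  primitive_on T f q -> forall t, 0 <= t <= T ->
  `|q t| <= `|q 0| + \int[mu]_(r in `[0, T]) `|f r|.
Proof.
move=> fi qf t /andP[t0 tT]; rewrite (qf t) ?t0//.
apply: le_trans (ler_normD _ _) _; rewrite lerD2l.
have it : mu.-integrable `[0, t] (EFin \o f).
  by apply: integrable_subset_itv fi => //; apply: subset_itvl; rewrite bnd_simp.
apply: le_trans (le_normr_Rintegral _ it) _ => //.
rewrite [leRHS](Rintegral_itv_split t0 tT (lexx T)); last exact: integrable_norm.
by rewrite lerDl Rintegral_ge0.
Qed.

(** A local bound of the increments of [phi] by those of [V] telescopes along a
    subdivision of mesh less than [h]. *)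
Lemma increment_bound_global (phi V : R -> R) T e h : 0 <= T -> 0 < h ->
  (forall s t, 0 <= s -> s <= t -> t <= T -> t - s < h ->
    `|phi t - phi s| <= e * (V t - V s)) ->
  `|phi T - phi 0| <= e * (V T - V 0).
Proof.
move=> T0 h0 loc.
pose n := (Num.truncn (T / h)).+1.
have n0 : (0 : R) < n%:R by rewrite ltr0n.
have Tn : T / n%:R < h.
  by rewrite ltr_pdivrMr// mulrC -ltr_pdivrMr//; exact: truncnS_gt.
have n00 : n%:R != 0 :> R by rewrite gt_eqF.
suff H k : (k <= n)%N ->
    `|phi (k%:R * (T / n%:R)) - phi 0| <= e * (V (k%:R * (T / n%:R)) - V 0).
  by have := H n (leqnn n); rewrite mulrC divfK.
elim: k => [|k IH] kn; first by rewrite mul0r !subrr normr0 mulr0.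
have Tn0 : 0 <= T / n%:R by rewrite divr_ge0// ltW.
have e1 : k.+1%:R * (T / n%:R) = k%:R * (T / n%:R) + T / n%:R.
  by rewrite -natr1 mulrDl mul1r.
have L : `|phi (k.+1%:R * (T / n%:R)) - phi (k%:R * (T / n%:R))| <=
   e * (V (k.+1%:R * (T / n%:R)) - V (k%:R * (T / n%:R))).
  apply: loc.
  - by rewrite mulr_ge0.
  - by rewrite e1 lerDl.
  - by rewrite mulrA ler_pdivrMr// mulrC ler_wpM2l// ler_nat.
  - by rewrite e1 addrAC subrr add0r.
have := IH (ltnW kn).
move: L; rewrite !ler_norml.
move=> /andP[a b] /andP[c d]; apply/andP; split; lra.
Qed.

(** The chain rule for [q ^+ 2] when [q'] is only integrable.  On [[s, t]] the error
    [q t ^+ 2 - q s ^+ 2 - 2 \int f q] equals [\int f (q t + q s - 2 q)], which is at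
    most the integral of [|f|] times twice the oscillation of [q]; these errors add up
    to an arbitrarily small multiple of the integral of [|f|]. *)
Lemma primitive_sqr T f q : 0 <= T -> mu.-integrable `[0, T] (EFin \o f) ->
  primitive_on T f q ->
  q T ^+ 2 = q 0 ^+ 2 + 2 * \int[mu]_(r in `[0, T]) (f r * q r).
Proof.
move=> T0 fi qf.
have mq := primitive_measurable T0 fi qf.
have fqi : mu.-integrable `[0, T] (EFin \o (fun r => f r * q r)).
  apply: integrable_mul_bounded => // x; rewrite /= in_itv/=.
  exact: primitive_bounded fi qf x.
pose phi t := q t ^+ 2 - 2 * \int[mu]_(r in `[0, t]) (f r * q r).
pose V t := \int[mu]_(r in `[0, t]) `|f r|.
have nfi : mu.-integrable `[0, T] (EFin \o (fun r => `|f r|)).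
  exact: integrable_norm.
have phi0 : phi 0 = q 0 ^+ 2 by rewrite /phi set_itv1 Rintegral_set1 mulr0 subr0.
have V0 : V 0 = 0 by rewrite /V set_itv1 Rintegral_set1.
suff : phi T - phi 0 = 0.
  by rewrite phi0 /phi => /eqP; rewrite subr_eq0 subr_eq => /eqP ->.
apply/eqP; rewrite -normr_le0; apply/ler_addgt0Pr => e e0; rewrite add0r.
have VT : 0 <= V T by apply: Rintegral_ge0.
have e'0 : 0 < e / (V T + 1) by rewrite divr_gt0// ltr_wpDl.
have [h h0 mod] := primitive_modulus fi qf (divr_gt0 e'0 (ltr0n _ 2)).
have := @increment_bound_global phi V T (e / (V T + 1)) h T0 h0.
rewrite V0 subr0 => H; apply: (le_trans (H _)); last first.
  by rewrite -mulrA ler_piMr ?(ltW e0)// mulrC ler_pdivrMr ?ltr_wpDl// mul1r lerDl.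
move=> {H} s t s0 st tT tsh.
have sub := itv_oc_sub0 s0 tT.
have fist : mu.-integrable `]s, t] (EFin \o f) by exact: integrable_subset_itv fi.
have nfist : mu.-integrable `]s, t] (EFin \o (fun r => `|f r|)).
  exact: integrable_subset_itv nfi.
have fqist : mu.-integrable `]s, t] (EFin \o (fun r => f r * q r)).
  exact: integrable_subset_itv fqi.
have -> : V t - V s = \int[mu]_(r in `]s, t]) `|f r|.
  by rewrite /V (Rintegral_itv_split s0 st tT nfi); ring.
have -> : phi t - phi s = \int[mu]_(r in `]s, t]) (f r * (q t + q s) - 2 * (f r * q r)).
  rewrite RintegralB//; last 2 first.
    by apply: (integrable_mul_bounded (g := cst (q t + q s)) (M := `|q t + q s|)) => //.
    by apply: (@integrableZl _ _ _ mu `]s, t] _ 2 (EFin \o (fun r => f r * q r))).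
  rewrite RintegralZr// RintegralZl// -(primitive_increment fi qf)// /phi.
  by rewrite (Rintegral_itv_split s0 st tT fqi); ring.
rewrite -RintegralZl//.
have -> : \int[mu]_(r in `]s, t]) (f r * (q t + q s) - 2 * (f r * q r)) =
   \int[mu]_(r in `]s, t]) (f r * (q t + q s - 2 * q r)).
  by apply: eq_Rintegral => r _; ring.
have gb r : `]s, t]%classic r -> `|q t + q s - 2 * q r| <= e / (V T + 1).
  rewrite /= in_itv/= => /andP[sr rt].
  have := mod s r s0 (ltW sr) (le_trans rt tT) (le_lt_trans (lerB rt (lexx s)) tsh).
  have := mod r t (le_trans s0 (ltW sr)) rt tT (le_lt_trans (lerB (lexx t) (ltW sr)) tsh).
  rewrite !ltr_norml => /andP[a b] /andP[c d]; rewrite ler_norml; apply/andP; split; lra.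
have ii : mu.-integrable `]s, t] (EFin \o (fun r => f r * (q t + q s - 2 * q r))).
  apply: (integrable_mul_bounded _ _ _ gb) => //.
  apply: measurable_funB => //; apply: measurable_funM => //.
  exact: measurable_funS mq.
apply: (le_trans (le_normr_Rintegral _ ii)) => //.
apply: le_Rintegral => //.
- exact: integrable_norm ii.
- exact: (@integrableZl _ _ _ mu `]s, t] _ _ (EFin \o (fun r => `|f r|))).
- by move=> r str; rewrite normrM mulrC ler_wpM2r// gb.
Qed.

Lemma bounded_integrable_itv T g M : measurable_fun `[0, T] g ->
  (forall x, 0 <= x <= T -> `|g x| <= M) ->
  mu.-integrable `[0, T] (EFin \o g).
Proof.
move=> mg gM; apply: measurable_bounded_integrable => //.
  by rewrite /= lebesgue_measure_itv/=; case: ifP => // _; exact: ltry.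
exists M; split; first exact: num_real.
by move=> N MN x; rewrite /= in_itv/= => /gM /le_trans; apply; exact: ltW MN.
Qed.

(** Uniqueness for [D' = - b D] with [b >= 0]: the square of [D] cannot grow. *)
Lemma primitive_decay_eq0 T (b D : R -> R) : 0 <= T ->
  (forall r, 0 <= r <= T -> 0 <= b r) ->
  mu.-integrable `[0, T] (EFin \o (fun r => - (b r * D r))) ->
  primitive_on T (fun r => - (b r * D r)) D -> D 0 = 0 -> D T = 0.
Proof.
move=> T0 b0 fi DE D0; apply/eqP; rewrite -sqrf_eq0 eq_le sqr_ge0 andbT.
rewrite (primitive_sqr T0 fi DE) D0 expr0n /= add0r pmulr_rle0//.
have mD := primitive_measurable T0 fi DE.
apply: (@le_trans _ _ (\int[mu]_(r in `[0, T]) (cst 0 r))); last first.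
  by rewrite Rintegral_cst// mul0r.
apply: le_Rintegral => //.
- apply: integrable_mul_bounded => // x; rewrite /= in_itv/=.
  exact: primitive_bounded fi DE x.
- exact: integrable0.
- move=> x; rewrite /= in_itv/= => xT.
  by rewrite mulNr -mulrA -expr2 oppr_le0 mulr_ge0 ?sqr_ge0 ?b0.
Qed.

(** The right-hand side of the forward equation for the mass [m] of the state 1, with
    rates [up] from 0 to 1 and [down] from 1 to 0. *)
Definition drift (up down m : R -> R) r := up r * (1 - m r) - down r * m r.

Lemma drift_integrable (up down m : R -> R) T :
  mu.-integrable `[0, T] (EFin \o up) -> mu.-integrable `[0, T] (EFin \o down) ->
  measurable_fun `[0, T] m -> (forall r, 0 <= r <= T -> 0 <= m r <= 1) ->
  mu.-integrable `[0, T] (EFin \o drift up down m).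
Proof.
move=> ui di mm m01.
have i1 : mu.-integrable `[0, T] (EFin \o (fun r => up r * (1 - m r))).
  apply: (integrable_mul_bounded (M := 1)) => //.
    exact: measurable_funB.
  move=> x; rewrite /= in_itv/= => /m01 /andP[? ?].
  by rewrite ler_norml; apply/andP; split; lra.
have i2 : mu.-integrable `[0, T] (EFin \o (fun r => down r * m r)).
  apply: (integrable_mul_bounded (M := 1)) => //.
  move=> x; rewrite /= in_itv/= => /m01 /andP[? ?].
  by rewrite ler_norml; apply/andP; split; lra.
exact: (integrableB _ i1 i2).
Qed.

Lemma integrable_itv_le s T f : s <= T -> mu.-integrable `[0, T] (EFin \o f) ->
  mu.-integrable `[0, s] (EFin \o f).
Proof.
by move=> sT; apply: integrable_subset_itv => //; apply: subset_itvl; rewrite bnd_simp.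
Qed.

Lemma drift_unique (up down m1 m2 : R -> R) T : 0 <= T ->
  (forall r, 0 <= r <= T -> 0 <= up r) ->
  (forall r, 0 <= r <= T -> 0 <= down r) ->
  mu.-integrable `[0, T] (EFin \o up) -> mu.-integrable `[0, T] (EFin \o down) ->
  measurable_fun `[0, T] m1 -> (forall r, 0 <= r <= T -> 0 <= m1 r <= 1) ->
  measurable_fun `[0, T] m2 -> (forall r, 0 <= r <= T -> 0 <= m2 r <= 1) ->
  primitive_on T (drift up down m1) m1 -> primitive_on T (drift up down m2) m2 ->
  m1 0 = m2 0 -> m1 T = m2 T.
Proof.
move=> T0 u0 d0 ui di mm1 m101 mm2 m201 e1 e2 e0.
have i1 := drift_integrable ui di mm1 m101.
have i2 := drift_integrable ui di mm2 m201.
have E r : drift up down m1 r - drift up down m2 r =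
    - ((up r + down r) * (m1 r - m2 r)) by rewrite /drift; ring.
have i : mu.-integrable `[0, T]
    (EFin \o (fun r => - ((up r + down r) * (m1 r - m2 r)))).
  rewrite [X in mu.-integrable _ X](_ : _ =
    ((EFin \o drift up down m1) \- (EFin \o drift up down m2))%E).
    exact: integrableB.
  by apply/funext => r /=; rewrite -EFinB E.
apply/eqP; rewrite -subr_eq0; apply/eqP.
apply: (@primitive_decay_eq0 T _ (fun r => m1 r - m2 r) T0 _ i) => /=.
- by move=> r rT; rewrite addr_ge0 ?u0 ?d0.
- move=> t tT; have /andP[t0 tT'] := tT; rewrite e1// e2// e0.
  under [X in _ = _ + X]eq_Rintegral do rewrite -E.
  rewrite [X in _ = _ + X]RintegralB//; last 2 first.
  - exact: integrable_itv_le tT' i1.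
  - exact: integrable_itv_le tT' i2.
  by ring.
- by rewrite e0 subrr.
Qed.

Lemma primitive_expR (c T : R) : 0 < c ->
  primitive_on T (fun r => - c * expR (- c * r)) (fun r => expR (- c * r)).
Proof.
move=> c0 t /andP[t0 _]; rewrite mulr0 expR0.
have [->|tn0] := eqVneq t 0; first by rewrite set_itv1 Rintegral_set1 mulr0 expR0 addr0.
have t0' : 0 < t by rewrite lt_def tn0.
have cE : continuous (fun r : R^o => expR (- c * r)).
  move=> x; apply: continuous_comp; last exact: continuous_expR.
  by apply: continuousM => //; apply: (@continuousN _ R^o); exact: cst_continuous.
rewrite /Rintegral (@continuous_FTC2 _ _ (fun r => expR (- c * r)))//=.
- by rewrite mulr0 expR0; ring.
- apply: continuous_subspaceT => x.
  by apply: cvgM; [exact: cvg_cst|exact: cE].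
- split.
  + by move=> x _; exact: ex_derive.
  + by apply: cvg_at_right_filter; exact: cE.
  + by apply: cvg_at_left_filter; exact: cE.
- move=> x _; rewrite derive1_comp// derive1E.
  have /funeqP -> := @derive_expR R.
  by rewrite derive1Ml// derive1_id mulr1 mulrC.
Qed.

(** A function that is at least [eta] on one interval of length [h] in each period has
    an integral that grows linearly. *)
Lemma Rintegral_recurrent_ge g (tau h t0 eta : R) : 0 < tau -> 0 < h -> h <= tau ->
  0 <= t0 -> 0 < eta ->
  (forall T, 0 <= T -> mu.-integrable `[0, T] (EFin \o g)) ->
  (forall t, 0 <= t -> 0 <= g t) ->
  (forall (n : nat) t, t0 + n%:R * tau < t <= t0 + n%:R * tau + h -> eta <= g t) ->
  exists c C : R, 0 < c /\ forall T, 0 <= T ->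
    c * T - C <= \int[mu]_(r in `[0, T]) g r.
Proof.
move=> tau0 h0 htau t00 eta0 gi g0 gn.
pose a n := t0 + n%:R * tau.
have a0 n : 0 <= a n by rewrite addr_ge0// mulr_ge0// ltW.
have aS n : a n.+1 = a n + tau by rewrite /a -natr1; ring.
have pos A : A `<=` `[0, +oo[ -> 0 <= \int[mu]_(r in A) g r.
  by move=> sA; apply: Rintegral_ge0 => x /sA; rewrite /= in_itv/= andbT => /g0.
have I n : n%:R * (eta * h) <= \int[mu]_(r in `[0, a n]) g r.
  elim: n => [|n IH].
    by rewrite mul0r pos// => x; rewrite /= !in_itv/= andbT => /andP[].
  have an : a n <= a n + h by rewrite lerDl ltW.
  have ah : a n + h <= a n.+1 by rewrite aS lerD2l.
  rewrite (Rintegral_itv_split (a0 n) (le_trans an ah) (lexx _)) ?gi//.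
  have sub0 : `](a n), (a n.+1)] `<=` `[0, a n.+1] by exact: itv_oc_sub0.
  have sub1 : `](a n), (a n + h)] `<=` `[0, a n.+1] by exact: itv_oc_sub0.
  rewrite -natr1 mulrDl mul1r lerD//.
  apply: (@le_trans _ _ (\int[mu]_(r in `](a n), (a n + h)]) g r)); last first.
    apply: fine_le.
    - by apply: integrable_fin_num => //; exact: (integrable_subset_itv _ sub1 (gi _ (a0 n.+1))).
    - by apply: integrable_fin_num => //; exact: (integrable_subset_itv _ sub0 (gi _ (a0 n.+1))).
    apply: ge0_subset_integral => //.
    - exact: measurable_int (integrable_subset_itv _ sub0 (gi _ (a0 _))).
    - move=> x /sub0; rewrite /= in_itv/= => /andP[x0 _]; rewrite lee_fin; exact: g0.
    - by apply: subset_itvl; rewrite bnd_simp.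
  rewrite (_ : eta * h = \int[mu]_(r in `](a n), (a n + h)]) (cst eta r)).
    apply: le_Rintegral => //.
    - apply: (integrable_subset_itv (T := a n.+1)) => //.
      by apply: (@bounded_integrable_itv _ _ `|eta|).
    - exact: integrable_subset_itv (gi _ (a0 n.+1)).
    - by move=> x; rewrite /= in_itv/= => /gn.
  rewrite Rintegral_cst//= lebesgue_measure_itv/= lte_fin ltrDl h0 -EFinB /=.
  by ring.
exists (eta * h / tau), (eta * h / tau * (t0 + tau)); split.
  by rewrite divr_gt0// mulr_gt0.
move=> T T0; rewrite -mulrBr.
have c0 : 0 < eta * h / tau by rewrite divr_gt0// mulr_gt0.
have [Tt|tT] := ltP T t0.
  apply: (@le_trans _ _ 0); last first.
    by apply: pos => x; rewrite /= !in_itv/= andbT => /andP[].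
  by rewrite pmulr_rle0//; lra.
pose n := Num.truncn ((T - t0) / tau).
have Tt0 : 0 <= (T - t0) / tau by rewrite divr_ge0 ?subr_ge0 ?(ltW tau0).
have /andP[n1 n2] : n%:R <= (T - t0) / tau < n.+1%:R by exact: truncn_itv.
have anT : a n <= T by move: n1; rewrite ler_pdivlMr// /a; lra.
rewrite (Rintegral_itv_split (a0 n) anT (lexx T)) ?gi//.
apply: le_trans (_ : n%:R * (eta * h) <= _).
  rewrite mulrAC ler_pdivrMr//.
  have -> : n%:R * (eta * h) * tau = eta * h * (n%:R * tau) by ring.
  rewrite ler_pM2l ?mulr_gt0//.
  by move: n2; rewrite ltr_pdivrMr// -natr1; lra.
rewrite -[leLHS]addr0 lerD// pos// => x; rewrite /= !in_itv/= andbT => /andP[].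
by move=> /(le_lt_trans (a0 n)) /ltW.
Qed.

Lemma periodic_sqr_growth (q f : R -> R) (tau t0 : R) : 0 < tau -> 0 <= t0 ->
  (forall T, 0 <= T -> mu.-integrable `[0, T] (EFin \o f)) ->
  (forall T, primitive_on T f q) ->
  (forall t, 0 <= t -> q (t + tau) = q t) -> q t0 != 0 ->
  exists c C : R, 0 < c /\ forall T, 0 <= T ->
    c * T - C <= \int[mu]_(r in `[0, T]) q r ^+ 2.
Proof.
move=> tau0 t00 fi qf per qt0.
have q0 : 0 < `|q t0| by rewrite normr_gt0.
have t01 : 0 <= t0 + 1 by rewrite addr_ge0.
have [h h0 mod] := primitive_modulus (fi _ t01) (qf _) (divr_gt0 q0 (ltr0n _ 2)).
pose k := Num.min (h / 2) (Num.min 1 tau).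
have k0 : 0 < k by rewrite !lt_min tau0 ltr01 divr_gt0.
have [kh k1 kt] : [/\ k <= h / 2, k <= 1 & k <= tau].
  by split; rewrite /k !ge_min lexx ?orbT.
have pern (n : nat) t : 0 <= t -> q (t + n%:R * tau) = q t.
  elim: n t => [|n IH] t tt; first by rewrite mul0r addr0.
  by rewrite -natr1 mulrDl mul1r addrA per ?IH// addr_ge0// mulr_ge0// ltW.
apply: (@Rintegral_recurrent_ge (fun r => q r ^+ 2) tau k t0 (`|q t0| ^+ 2 / 4)) => //.
- by rewrite divr_gt0// exprn_gt0.
- move=> T T0.
  rewrite (_ : (fun r => q r ^+ 2) = (fun r => q r * q r)); last first.
    by apply/funext => r; rewrite expr2.
  have mq := primitive_measurable T0 (fi _ T0) (qf T).
  have qb := primitive_bounded (fi _ T0) (qf T).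
  apply: integrable_mul_bounded => //; last first.
    by move=> x; rewrite /= in_itv/=; exact: qb.
  exact: bounded_integrable_itv mq qb.
- by move=> t _; exact: sqr_ge0.
- move=> n t /andP[nt tn].
  have [s st] : exists s, t = s + n%:R * tau by exists (t - n%:R * tau); rewrite subrK.
  have ts : t0 < s by move: nt; rewrite st; lra.
  have sk : s <= t0 + k by move: tn; rewrite st; lra.
  rewrite st pern; last by rewrite (le_trans t00)// ltW.
  have := mod t0 s t00 (ltW ts); have -> : (s <= t0 + 1) by lra.
  have -> : s - t0 < h by lra.
  move=> /(_ isT isT) qs.
  have : `|q t0| / 2 <= `|q s|.
    have := ler_normD (q s) (q t0 - q s); rewrite addrC subrK distrC => H.
    lra.
  move=> qs2; rewrite -(real_normK (num_real (q s))).
  have : (`|q t0| / 2) ^+ 2 <= `|q s| ^+ 2 by rewrite lerXn2r// nnegrE divr_ge0.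
  by rewrite expr_div_n; lra.
Qed.

End primitives.

(** * Pointwise cost of a mixture of fluxes *)

Section pointwise.
Context {R : realType}.
Implicit Types (e E x y z a lam Q : R).

Lemma measurable_invr : measurable_fun [set: R] (@GRing.inv R).
Proof.
rewrite (_ : [set: R] = [set~ 0] `|` [set 0]); last by rewrite setUC setUv.
apply/measurable_funU => //; first exact: measurableC.
split; last exact: measurable_fun_set1.
apply: open_continuous_measurable_fun.
  by apply: closed_openC; exact: closed_eq.
by move=> x; rewrite inE => /= /eqP x0; exact: inv_continuous.
Qed.

(** A state of mass [x] is left with flux [a * x].  When this mass becomes [z], the rate
    [(1 - e) * a * x / z] produces the flux [(1 - e) * (a * x)].  Since [z] is at least
    [(1 - e) * x], scaling the flux always saves a fraction [e] of the control cost. *)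
Lemma mix_flux_cost a x y z e : 0 <= x -> 0 <= y -> 0 <= e <= 1 / 2 ->
  z = (1 - e) * x + e * y ->
  ((1 - e) * a * x / z) ^+ 2 * z <= (1 - e) * (a ^+ 2 * x).
Proof.
move=> x0 y0 /andP[e0 e1] zE.
have zx : (1 - e) * x <= z by rewrite zE lerDl mulr_ge0.
have [z0|zn0] := eqVneq z 0.
  by rewrite z0 mulr0; apply: mulr_ge0; [lra|rewrite mulr_ge0 ?sqr_ge0].
have zp : 0 < z.
  by rewrite lt_def zn0 (le_trans _ zx)//; apply: mulr_ge0 => //; lra.
have -> : ((1 - e) * a * x / z) ^+ 2 * z = ((1 - e) * a ^+ 2 * x) * ((1 - e) * x) / z.
  by field.
rewrite ler_pdivrMr// [leRHS](_ : _ = ((1 - e) * a ^+ 2 * x) * z); last by ring.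
have a0 := sqr_ge0 a; rewrite ler_wpM2l//.
by apply: mulr_ge0 => //; apply: mulr_ge0 => //; lra.
Qed.

(** In the less likely state ([x <= 1 / 2]) the mixture also has more mass to carry the
    flux, up to the distance [E] of the uncontrolled chain from equilibrium, so a lower
    rate is enough.  To first order in [e] the saving is then [e * (2 * x * a) ^+ 2] or
    more; the factor that contains [e + E] absorbs the remaining terms. *)
Lemma mix_flux_gain a x y z e E : 0 <= x <= 1 / 2 -> (1 - E) / 2 <= y ->
  0 <= e <= 1 / 2 -> 0 <= E <= 1 ->
  z = (1 - e) * x + e * y ->
  ((1 - e) * a * x / z) ^+ 2 * z <=
    a ^+ 2 * x - e * (2 * x * a) ^+ 2 * (1 - (e + E) / 2).
Proof.
move=> /andP[x0 x1] yE /andP[e0 e1] /andP[E0 E1] zE.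
have y0 : 0 <= y by lra.
have zx : (1 - e) * x <= z by rewrite zE lerDl mulr_ge0.
set W := 1 - (e + E) / 2.
have [->|xn0] := eqVneq x 0.
  by rewrite !(mulr0, mul0r) !expr0n /= !(mulr0, mul0r) subr0.
have xp : 0 < x by rewrite lt_def xn0.
have zp : 0 < z by apply: lt_le_trans zx; rewrite mulr_gt0//; lra.
have -> : ((1 - e) * a * x / z) ^+ 2 * z = a ^+ 2 * x * ((1 - e) ^+ 2 * x / z).
  by field; rewrite gt_eqF.
have -> : a ^+ 2 * x - e * (2 * x * a) ^+ 2 * W = a ^+ 2 * x * (1 - 4 * e * x * W).
  by ring.
apply: ler_wpM2l; first by apply: mulr_ge0; rewrite ?sqr_ge0.
rewrite ler_pdivrMr//.
have W0 : 0 <= W by rewrite /W; lra.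
have W1 : W <= 1 by rewrite /W; lra.
have u0 : 0 <= 1 - 4 * e * x * W.
  have h1 : e * x <= 1 / 4 by nra.
  have h2 : e * x * W <= e * x by rewrite ler_piMr// mulr_ge0.
  nra.
apply: (@le_trans _ _ ((1 - 4 * e * x * W) * ((1 - e) * x + e * ((1 - E) / 2)))); last first.
  by rewrite zE ler_wpM2l// lerD2l ler_wpM2l.
rewrite -subr_ge0.
(* As a function of x the difference is a concave quadratic: it is the interpolation
   between its values at 0 and 1/2 plus a nonnegative multiple of x (1/2 - x). *)
have -> : (1 - 4 * e * x * W) * ((1 - e) * x + e * ((1 - E) / 2)) - (1 - e) ^+ 2 * x =
  (1 - 2 * x) * (e * (1 - E) / 2) + x * (e ^+ 2 * E * (2 * W))
   + 4 * e * W * (1 - e) * (x * (1 / 2 - x)).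
  by rewrite /W; field.
have h1 : 0 <= 1 - 2 * x by lra.
have h2 : 0 <= 1 - E by lra.
have h3 : 0 <= 1 - e by lra.
have h4 : 0 <= 1 / 2 - x by lra.
by rewrite !addr_ge0// !mulr_ge0// ?divr_ge0// ?mulr_ge0.
Qed.

(** The saving is quadratic in the flux [2 * x * a]; its tangent at [lam * Q] is what can
    be integrated, because the flux times [Q] is controlled by the dynamics.  The error
    term uses [(1 - u / 2) * (1 + 2 * u) >= 1] for [0 <= u <= 3 / 2]. *)
Lemma mix_flux_gain_linear a x y z e E lam Q : 0 <= Q <= 1 -> x = (1 - Q) / 2 ->
  (1 - E) / 2 <= y -> 0 <= e <= 1 / 2 -> 0 <= E <= 1 -> 0 <= a -> 0 <= lam ->
  z = (1 - e) * x + e * y ->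
  e * (lam * (2 * x * a) * Q - lam ^+ 2 * Q ^+ 2 * (1 + 2 * (e + E)) / 2) <=
  2^-1 * (a ^+ 2 * x - ((1 - e) * a * x / z) ^+ 2 * z).
Proof.
move=> /andP[Q0 Q1] xQ yE eb Eb a0 lam0 zE.
have xb : 0 <= x <= 1 / 2 by apply/andP; split; lra.
have H := mix_flux_gain a xb yE eb Eb zE.
move: eb Eb => /andP[e0 e1] /andP[E0 E1].
suff : 0 <= e * ((2 * x * a) ^+ 2 * (1 - (e + E) / 2) / 2 -
   (lam * (2 * x * a) * Q - lam ^+ 2 * Q ^+ 2 * (1 + 2 * (e + E)) / 2)).
  by lra.
apply: mulr_ge0 => //.
set r := 2 * x * a; set u := e + E.
have u0 : 0 <= u <= 3 / 2 by rewrite /u; apply/andP; split; lra.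
have W0 : 0 < 1 - u / 2 by lra.
rewrite -(pmulr_rge0 _ W0).
have -> : (1 - u / 2) * (r ^+ 2 * (1 - u / 2) / 2 -
    (lam * r * Q - lam ^+ 2 * Q ^+ 2 * (1 + 2 * u) / 2)) =
    ((1 - u / 2) * r - lam * Q) ^+ 2 / 2 + (u * (3 / 2 - u)) * (lam * Q) ^+ 2 / 2.
  by field.
have h : 0 <= u * (3 / 2 - u) by apply: mulr_ge0; lra.
by rewrite addr_ge0// divr_ge0 ?sqr_ge0// mulr_ge0 ?sqr_ge0.
Qed.

End pointwise.

Section mixing.
Context {R : realType}.
Local Notation mu := (@lebesgue_measure R).

Definition occupation (m : R) (x : bool) : R := if x then m else 1 - m.

Definition mean_cost (kappa : R) (p : R -> R) (alpha : R -> bool -> R) (m : R -> R)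
    (t : R) : R :=
  2^-1 * (alpha t false ^+ 2 * occupation (m t) false +
          alpha t true ^+ 2 * occupation (m t) true) +
  kappa * (occupation (m t) false * p t + occupation (m t) true * (1 - p t)).

(** The two states together.  If [p >= 1 / 2] the state 0 is the less likely one: its
    saving is bounded below by the tangent line, while the flux out of the state 1 has
    the favourable sign and only [mix_flux_cost] is used for it.  If [p < 1 / 2] the
    states exchange their roles. *)
Lemma mixed_state_gain (a0 a1 b0 b1 p gam m e E lam k : R) :
  0 <= p <= 1 -> (1 - E) / 2 <= gam <= (1 + E) / 2 -> 0 <= e <= 1 / 2 ->
  0 <= E <= 1 -> 0 <= a0 -> 0 <= a1 -> 0 <= lam -> 0 <= k ->
  m = (1 - e) * p + e * gam ->
  b0 = (1 - e) * a0 * (1 - p) / (1 - m) -> b1 = (1 - e) * a1 * p / m ->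
  2^-1 * (b0 ^+ 2 * (1 - m) + b1 ^+ 2 * m) + k * ((1 - m) * p + m * (1 - p)) +
  e * (lam * (2 * a0 * (1 - p) - 2 * a1 * p) * (2 * p - 1)
       - lam ^+ 2 * (2 * p - 1) ^+ 2 * (1 + 2 * (e + E)) / 2
       - k / 2 * (2 * p - 1) ^+ 2 - k / 2 * E) <=
  2^-1 * (a0 ^+ 2 * (1 - p) + a1 ^+ 2 * p) + k * ((1 - p) * p + p * (1 - p)).
Proof.
move=> /andP[p0 p1] /andP[g0 g1] eb Eb a00 a10 lam0 k0 mE b0E b1E.
have m0E : 1 - m = (1 - e) * (1 - p) + e * (1 - gam) by rewrite mE; ring.
have [e0 e1] := andP eb; have [E0 E1] := andP Eb.
have K : k * ((1 - m) * p + m * (1 - p)) - k / 2 * e * ((2 * p - 1) ^+ 2 + E) <=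
    k * ((1 - p) * p + p * (1 - p)).
  rewrite -subr_ge0 mE.
  have -> : k * ((1 - p) * p + p * (1 - p)) -
    (k * ((1 - ((1 - e) * p + e * gam)) * p + ((1 - e) * p + e * gam) * (1 - p)) -
      k / 2 * e * ((2 * p - 1) ^+ 2 + E)) =
    k * e * ((E / 2 - (gam - 1 / 2)) * (1 - p) + (E / 2 + (gam - 1 / 2)) * p) by field.
  by rewrite mulr_ge0 ?mulr_ge0// addr_ge0// mulr_ge0//; lra.
have y0 : 0 <= gam by lra.
have y1 : 0 <= 1 - gam by lra.
have p1' : 0 <= 1 - p by lra.
have [q0|q0] := leP 0 (2 * p - 1).
- have S0 : e * (lam * (2 * (1 - p) * a0) * (2 * p - 1) -
     lam ^+ 2 * (2 * p - 1) ^+ 2 * (1 + 2 * (e + E)) / 2) <=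
     2^-1 * (a0 ^+ 2 * (1 - p) - b0 ^+ 2 * (1 - m)).
    rewrite b0E; apply: (mix_flux_gain_linear (y := 1 - gam)) => //; try lra.
  have S1 : b1 ^+ 2 * m <= a1 ^+ 2 * p.
    rewrite b1E; apply: le_trans (mix_flux_cost a1 p0 y0 eb mE) _.
    by rewrite ler_piMl ?mulr_ge0 ?sqr_ge0//; lra.
  have S2 : 0 <= e * (lam * (a1 * (p * (2 * p - 1)))) by rewrite !mulr_ge0.
  lra.
- have S0 : e * (lam * (2 * p * a1) * (1 - 2 * p) -
     lam ^+ 2 * (1 - 2 * p) ^+ 2 * (1 + 2 * (e + E)) / 2) <=
     2^-1 * (a1 ^+ 2 * p - b1 ^+ 2 * m).
    rewrite b1E; apply: (mix_flux_gain_linear (y := gam)) => //; try lra.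
  have S1 : b0 ^+ 2 * (1 - m) <= a0 ^+ 2 * (1 - p).
    rewrite b0E; apply: le_trans (mix_flux_cost a0 p1' y1 eb m0E) _.
    by rewrite ler_piMl ?mulr_ge0 ?sqr_ge0//; lra.
  have q0' : 0 <= 1 - 2 * p by lra.
  have S2 : 0 <= e * (lam * (a0 * ((1 - p) * (1 - 2 * p)))) by rewrite !mulr_ge0.
  have sq : (1 - 2 * p) ^+ 2 = (2 * p - 1) ^+ 2 by ring.
  rewrite sq in S0.
  lra.
Qed.

End mixing.

(** * The gain from mixing a control with the free chain *)

Section perturbation.
Context {R : realType}.
Local Notation mu := (@lebesgue_measure R).

(** [p] is the law of the chain controlled by [alpha], and it is also the flow that
    enters the running cost; [e] is the weight of the uncontrolled chain. *)
Context (s kappa e : R) (alpha : R -> bool -> R) (p : R -> R).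
Context (s_gt0 : 0 < s) (kappa_ge0 : 0 <= kappa) (e_gt0 : 0 < e) (e_le : e <= 1 / 2).
Context (alpha_adm : admissible alpha)
  (p_meas : forall T : R, 0 <= T -> measurable_fun `[0, T] p)
  (p01 : forall t, 0 <= t -> 0 <= p t <= 1)
  (pE : forall T, primitive_on T
     (drift (fun t => s + alpha t false) (fun t => s + alpha t true) p) p).

(** The law of the chain with control 0 started from [p 0]. *)
Definition free_mass t := 2^-1 + (p 0 - 2^-1) * expR (- (2 * s) * t).

Definition mixed_mass t := (1 - e) * p t + e * free_mass t.

Definition mixed_control t x :=
  (1 - e) * alpha t x * occupation (p t) x / occupation (mixed_mass t) x.

Let decay01 t : 0 <= t -> 0 <= expR (- (2 * s) * t) <= 1.
Proof.
move=> t0; rewrite expR_ge0 -[leRHS]expR0 ler_expR mulNr oppr_le0.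
by rewrite !mulr_ge0// ltW.
Qed.

Lemma free_mass_bounds t : 0 <= t ->
  (1 - expR (- (2 * s) * t)) / 2 <= free_mass t <= (1 + expR (- (2 * s) * t)) / 2.
Proof.
move=> /decay01 /andP[E0 E1]; have /andP[p0 p1] := p01 (lexx 0).
rewrite /free_mass; set E := expR _ in E0 E1 *.
have : 0 <= (p 0) * E by rewrite mulr_ge0.
have : 0 <= (1 - p 0) * E by rewrite mulr_ge0//; lra.
by move=> H1 H2; apply/andP; split; lra.
Qed.

Lemma free_mass01 t : 0 <= t -> 0 <= free_mass t <= 1.
Proof.
move=> t0; have /andP[E0 E1] := decay01 t0.
by have /andP[] := free_mass_bounds t0; move=> *; apply/andP; split; lra.
Qed.

Lemma mixed_mass01 t : 0 <= t -> 0 <= mixed_mass t <= 1.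
Proof.
move=> t0; have /andP[g0 g1] := free_mass01 t0; have /andP[p0 p1] := p01 t0.
have e0 := e_gt0; have e1 := e_le.
rewrite /mixed_mass; apply/andP; split.
  by rewrite addr_ge0// mulr_ge0//; lra.
rewrite -subr_ge0.
have -> : 1 - ((1 - e) * p t + e * free_mass t) =
  (1 - e) * (1 - p t) + e * (1 - free_mass t) by ring.
by rewrite addr_ge0// mulr_ge0//; lra.
Qed.

Lemma mixed_mass0 : mixed_mass 0 = p 0.
Proof. by rewrite /mixed_mass /free_mass mulr0 expR0; ring. Qed.

Lemma occupation_mixed t x : occupation (mixed_mass t) x =
  (1 - e) * occupation (p t) x + e * occupation (free_mass t) x.
Proof. by case: x; rewrite /occupation /mixed_mass; ring. Qed.

Lemma occupation_ge0 (m : R) x : 0 <= m <= 1 -> 0 <= occupation m x.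
Proof. by move=> /andP[? ?]; case: x => //=; lra. Qed.

Lemma occupation_mixed_ge t x : 0 <= t ->
  (1 - e) * occupation (p t) x <= occupation (mixed_mass t) x.
Proof.
move=> t0; rewrite occupation_mixed lerDl mulr_ge0 ?(ltW e_gt0)//.
exact/occupation_ge0/free_mass01.
Qed.

Lemma mixed_flux t x : 0 <= t ->
  mixed_control t x * occupation (mixed_mass t) x =
  (1 - e) * (alpha t x * occupation (p t) x).
Proof.
move=> t0; rewrite /mixed_control.
have [z0|zn0] := eqVneq (occupation (mixed_mass t) x) 0; last by field.
have := occupation_mixed_ge x t0; rewrite z0 mulr0 => H.
have x0 : 0 <= occupation (p t) x := occupation_ge0 x (p01 t0).
have -> : occupation (p t) x = 0.
  apply/eqP; rewrite eq_le x0 andbT -(@pmulr_rle0 _ (1 - e))//.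
  by have := e_le; lra.
by rewrite !mulr0.
Qed.

Lemma mixed_control_bounds t x : 0 <= t -> 0 <= mixed_control t x <= alpha t x.
Proof.
move=> t0; have x0 : 0 <= occupation (p t) x := occupation_ge0 x (p01 t0).
have z0 : 0 <= occupation (mixed_mass t) x := occupation_ge0 x (mixed_mass01 t0).
have a0 : 0 <= alpha t x by case: alpha_adm => + _; apply.
have e1 : 0 <= 1 - e by have := e_le; lra.
rewrite /mixed_control; apply/andP; split; first by rewrite !mulr_ge0// invr_ge0.
have [->|zn0] := eqVneq (occupation (mixed_mass t) x) 0.
  by rewrite invr0 mulr0.
rewrite ler_pdivrMr ?lt_def ?zn0//.
rewrite [leLHS](_ : _ = alpha t x * ((1 - e) * occupation (p t) x)); last by ring.
by rewrite ler_wpM2l// occupation_mixed_ge.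
Qed.

Lemma alpha_integrable T x : 0 <= T ->
  mu.-integrable `[0, T] (EFin \o alpha ^~ x).
Proof. by case: alpha_adm => _; apply. Qed.

Lemma rate_integrable (a : R -> bool -> R) T x : admissible a -> 0 <= T ->
  mu.-integrable `[0, T] (EFin \o (fun t => s + a t x)).
Proof.
move=> [_ ai] T0.
have is' : mu.-integrable `[0, T] (EFin \o cst s).
  by apply: (@bounded_integrable_itv _ _ _ `|s|).
exact: (integrableD _ is' (ai T x T0)).
Qed.


Lemma decay_measurable (T : R) : measurable_fun `[0, T] (fun t => expR (- (2 * s) * t)).
Proof.
by apply: measurableT_comp; [exact: measurable_expR|exact: measurable_funM].
Qed.

Lemma decay_integrable (T : R) :
  mu.-integrable `[0, T] (EFin \o (fun t => expR (- (2 * s) * t))).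
Proof.
apply: (bounded_integrable_itv (M := 1)); first exact: decay_measurable.
by move=> x /andP[x0 _]; have /andP[E0 E1] := decay01 x0; rewrite ger0_norm.
Qed.

Lemma free_mass_measurable (T : R) : measurable_fun `[0, T] free_mass.
Proof.
by apply: measurable_funD => //; apply: measurable_funM => //; exact: decay_measurable.
Qed.

Lemma mixed_mass_measurable (T : R) : 0 <= T -> measurable_fun `[0, T] mixed_mass.
Proof.
move=> T0; apply: measurable_funD; apply: measurable_funM => //.
  exact: p_meas.
exact: free_mass_measurable.
Qed.

Lemma occupation_measurable (m : R -> R) (T : R) x : measurable_fun `[0, T] m ->
  measurable_fun `[0, T] (fun t => occupation (m t) x).
Proof. by move=> mm; case: x => //; exact: measurable_funB. Qed.

Lemma mixed_control_admissible : admissible mixed_control.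
Proof.
split=> [t x t0|T x T0]; first by have /andP[] := mixed_control_bounds x t0.
have ai := alpha_integrable x T0.
apply: (le_integrable _ _ _ ai) => //; last first.
  move=> t; rewrite /= in_itv/= => /andP[t0 _].
  have /andP[b0 ba] := mixed_control_bounds x t0.
  by rewrite lee_fin !ger0_norm// (le_trans b0).
apply/measurable_EFinP; apply: measurable_funM; last first.
  apply: (@measurableT_comp _ _ _ _ _ _ (@GRing.inv R)).
    exact: measurable_invr.
  by apply: occupation_measurable; exact: mixed_mass_measurable.
apply: measurable_funM; last first.
  by apply: occupation_measurable; exact: p_meas.
by apply: measurable_funM => //; apply/measurable_EFinP; exact: measurable_int ai.
Qed.

Let up t := s + alpha t false.
Let down t := s + alpha t true.

Lemma mass_drift_integrable T : 0 <= T ->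
  mu.-integrable `[0, T] (EFin \o drift up down p).
Proof.
move=> T0; apply: drift_integrable; [exact: rate_integrable..|exact: p_meas|].
by move=> r /andP[r0 _]; exact: p01.
Qed.

Lemma mixed_drift t : 0 <= t ->
  drift (fun t => s + mixed_control t false) (fun t => s + mixed_control t true)
    mixed_mass t =
  (1 - e) * drift up down p t +
  e * (p 0 - 2^-1) * (- (2 * s) * expR (- (2 * s) * t)).
Proof.
move=> t0; rewrite /drift.
have := mixed_flux false t0; have := mixed_flux true t0; rewrite /occupation.
set b1 := mixed_control t true; set b0 := mixed_control t false => h1 h0.
have -> : (s + b0) * (1 - mixed_mass t) - (s + b1) * mixed_mass t =
  s * (1 - 2 * mixed_mass t) + b0 * (1 - mixed_mass t) - b1 * mixed_mass t by ring.
by rewrite h1 h0 /mixed_mass /free_mass /up /down; field.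
Qed.

(** Laws and fluxes are mixed with the same weights and the forward equation is linear
    in them, so the mixture is the law of the chain controlled by [mixed_control]. *)
Lemma mixed_mass_primitive T :
  primitive_on T (drift (fun t => s + mixed_control t false)
    (fun t => s + mixed_control t true) mixed_mass) mixed_mass.
Proof.
move=> t /andP[t0 _].
rewrite (@eq_Rintegral _ _ _ mu _ (fun r => (1 - e) * drift up down p r +
  e * (p 0 - 2^-1) * (- (2 * s) * expR (- (2 * s) * r)))); last first.
  by move=> r; rewrite inE/= in_itv/= => /andP[r0 _]; rewrite mixed_drift.
have s20 : 0 < 2 * s by rewrite mulr_gt0.
have i1 := mass_drift_integrable t0.
have i2 : mu.-integrable `[0, t] (EFin \o (fun r => - (2 * s) * expR (- (2 * s) * r))).
  exact: (integrableZl _ (- (2 * s)) (decay_integrable t)).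
rewrite RintegralD//; last 2 first.
- exact: (integrableZl _ (1 - e) i1).
- exact: (integrableZl _ (e * (p 0 - 2^-1)) i2).
rewrite RintegralZl// RintegralZl//.
have t_t : 0 <= t <= t by rewrite t0 lexx.
have := primitive_expR s20 t_t; rewrite mulr0 expR0 => H.
have := pE t_t => /= H2.
rewrite mixed_mass0 /mixed_mass {1}H2 /free_mass {1}H; ring.
Qed.


Lemma control_measurable (a : R -> bool -> R) (T : R) x : admissible a -> 0 <= T ->
  measurable_fun `[0, T] (a ^~ x).
Proof. by move=> [_ ai] T0; apply/measurable_EFinP; exact: measurable_int (ai T x T0). Qed.

Lemma mean_cost_measurable (a : R -> bool -> R) (m : R -> R) (T : R) :
  admissible a -> 0 <= T -> measurable_fun `[0, T] m ->
  measurable_fun `[0, T] (mean_cost kappa p a m).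
Proof.
move=> aa T0 mm.
have mo := fun x => occupation_measurable x mm.
have ma := fun x => control_measurable x aa T0.
have mp := p_meas T0.
apply: measurable_funD; apply: measurable_funM => //; apply: measurable_funD;
  apply: measurable_funM => //; last exact: measurable_funB.
- exact: measurable_funX.
- exact: measurable_funX.
Qed.

Lemma mean_cost_ge0 (a : R -> bool -> R) (m : R -> R) t :
  0 <= t -> 0 <= m t <= 1 -> 0 <= mean_cost kappa p a m t.
Proof.
move=> t0 m01; have o0 := fun x => occupation_ge0 x m01.
have /andP[p0 p1] := p01 t0; have p1' : 0 <= 1 - p t by lra.
by rewrite /mean_cost !addr_ge0// mulr_ge0// addr_ge0// mulr_ge0// sqr_ge0.
Qed.

Let q t := 2 * p t - 1.

Let q_measurable (T : R) : 0 <= T -> measurable_fun `[0, T] q.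
Proof.
by move=> T0; apply: measurable_funB => //; apply: measurable_funM => //; exact: p_meas.
Qed.

Let q1 t : 0 <= t -> `|q t| <= 1.
Proof. by move=> /p01 /andP[? ?]; rewrite ler_norml /q; apply/andP; split; lra. Qed.

Let q2_integrable T : 0 <= T -> mu.-integrable `[0, T] (EFin \o (fun t => q t ^+ 2)).
Proof.
move=> T0; apply: (bounded_integrable_itv (M := 1)).
  by apply: measurable_funX; exact: q_measurable.
by move=> x /andP[/q1 x1 _]; rewrite normrX exprn_ile1.
Qed.

Let fq_integrable T : 0 <= T ->
  mu.-integrable `[0, T] (EFin \o (fun t => drift up down p t * q t)).
Proof.
move=> T0; apply: (integrable_mul_bounded (M := 1)) => //.
- exact: mass_drift_integrable.
- exact: q_measurable.
- by move=> x; rewrite /= in_itv/= => /andP[/q1].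
Qed.

(** The integrand is [q q' / 2], whose integral is [(q T ^+ 2 - q 0 ^+ 2) / 4]. *)
Lemma drift_correlation_ge T : 0 <= T ->
  - 4^-1 <= \int[mu]_(r in `[0, T]) (drift up down p r * q r).
Proof.
move=> T0; have fi := mass_drift_integrable T0.
have f2i := integrable_scale 2 fi.
have qE : primitive_on T (fun r => 2 * drift up down p r) q.
  move=> t tT; rewrite /q RintegralZl//; last first.
    by apply: integrable_itv_le fi; have /andP[] := tT.
  by rewrite {1}(pE tT); rewrite -/up -/down; ring.
have := primitive_sqr T0 f2i qE.
under eq_Rintegral do rewrite -mulrA.
rewrite RintegralZl//; last exact: fq_integrable.
have := sqr_ge0 (q T); have : q 0 ^+ 2 <= 1.
  by rewrite -real_normK ?num_real// exprn_ile1// q1.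
lra.
Qed.

Lemma decay_integral_le T : 0 <= T ->
  \int[mu]_(r in `[0, T]) expR (- (2 * s) * r) <= (2 * s)^-1.
Proof.
move=> T0; have s20 : 0 < 2 * s by rewrite mulr_gt0.
have TT : 0 <= T <= T by rewrite T0 lexx.
have := primitive_expR s20 TT; rewrite RintegralZl//; last exact: decay_integrable.
rewrite mulr0 expR0 -[leRHS]mul1r ler_pdivlMr// => H.
have := expR_ge0 (- (2 * s) * T); rewrite H; lra.
Qed.

(** The bound of [mixed_state_gain] for [lam = 2 * s].  Its flux term has been expressed
    by the drift: [2 alpha_0 (1 - p) - 2 alpha_1 p = q' + 2 s q].  With this [lam] the
    coefficient [2 s lam - lam^2 / 2] of [q ^+ 2] is the largest possible. *)
Definition gain t :=
  e * (4 * s * (drift up down p t * q t) + (2 * s ^+ 2 * (1 - 2 * e) - kappa / 2) * q t ^+ 2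
       - (4 * s ^+ 2 + kappa / 2) * expR (- (2 * s) * t)).

Lemma gain_integrable T : 0 <= T -> mu.-integrable `[0, T] (EFin \o gain).
Proof.
move=> T0.
have i1 := integrable_scale (4 * s) (fq_integrable T0).
have i2 := integrable_scale (2 * s ^+ 2 * (1 - 2 * e) - kappa / 2) (q2_integrable T0).
have i3 := integrable_scale (4 * s ^+ 2 + kappa / 2) (decay_integrable T).
exact: (integrable_scale e (integrable_sub (integrable_add i1 i2) i3)).
Qed.

Lemma gain_integral_ge T : 0 <= T ->
  e * ((2 * s ^+ 2 * (1 - 2 * e) - kappa / 2) * \int[mu]_(r in `[0, T]) q r ^+ 2
       - (s + (4 * s ^+ 2 + kappa / 2) / (2 * s))) <=
  \int[mu]_(r in `[0, T]) gain r.
Proof.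
move=> T0.
have i1 := integrable_scale (4 * s) (fq_integrable T0).
have i2 := integrable_scale (2 * s ^+ 2 * (1 - 2 * e) - kappa / 2) (q2_integrable T0).
have i3 := integrable_scale (4 * s ^+ 2 + kappa / 2) (decay_integrable T).
rewrite RintegralZl//; last first.
  exact: (integrable_sub (integrable_add i1 i2) i3).
rewrite RintegralB//; last exact: (integrable_add i1 i2).
rewrite RintegralD//.
rewrite RintegralZl//; last exact: fq_integrable.
rewrite RintegralZl//; last exact: q2_integrable.
rewrite RintegralZl//; last exact: decay_integrable.
rewrite ler_pM2l//.
have h1 : - s <= 4 * s * \int[mu]_(r in `[0, T]) (drift up down p r * q r).
  by have := drift_correlation_ge T0; rewrite -(ler_pM2l s_gt0); lra.
have h2 : (4 * s ^+ 2 + kappa / 2) * \int[mu]_(r in `[0, T]) expR (- (2 * s) * r) <=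
    (4 * s ^+ 2 + kappa / 2) / (2 * s).
  apply: ler_wpM2l; last exact: decay_integral_le.
  by rewrite addr_ge0 ?divr_ge0// mulr_ge0// sqr_ge0.
lra.
Qed.

Lemma mean_cost_gain_pointwise t : 0 <= t ->
  mean_cost kappa p mixed_control mixed_mass t + gain t <= mean_cost kappa p alpha p t.
Proof.
move=> t0; have e0 := e_gt0.
have eb : 0 <= e <= 1 / 2 by rewrite ltW.
have a0 x : 0 <= alpha t x by case: alpha_adm => + _; apply.
have s20 : 0 <= 2 * s by rewrite mulr_ge0// ltW.
have := mixed_state_gain (p01 t0) (free_mass_bounds t0) eb (decay01 t0)
  (a0 false) (a0 true) s20 kappa_ge0 (erefl (mixed_mass t))
  (erefl (mixed_control t false)) (erefl (mixed_control t true)).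
rewrite /mean_cost /occupation; apply: le_trans; rewrite lerD2l /gain ler_pM2l//.
have /andP[E0 E1] := decay01 t0; set E := expR _ in E0 E1 *.
have q21 : q t ^+ 2 <= 1 by rewrite -real_normK ?num_real// exprn_ile1// q1.
rewrite -subr_ge0.
have -> : 2 * s * (2 * alpha t false * (1 - p t) - 2 * alpha t true * p t) *
  (2 * p t - 1) - (2 * s) ^+ 2 * (2 * p t - 1) ^+ 2 * (1 + 2 * (e + E)) / 2 -
  kappa / 2 * (2 * p t - 1) ^+ 2 - kappa / 2 * E -
  (4 * s * (drift up down p t * q t) +
    (2 * s ^+ 2 * (1 - 2 * e) - kappa / 2) * q t ^+ 2 -
    (4 * s ^+ 2 + kappa / 2) * E) = 4 * s ^+ 2 * E * (1 - q t ^+ 2).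
  by rewrite /drift /up /down /q; field.
apply: mulr_ge0; last by rewrite subr_ge0.
by apply: mulr_ge0 => //; apply: mulr_ge0; rewrite ?sqr_ge0.
Qed.

(** If the cost of [alpha] is infinite there is nothing to prove.  Otherwise the cost of
    the mixture is integrable too, by the pointwise bound, and the two integrals can be
    subtracted. *)
Lemma mean_cost_gain T : 0 <= T ->
  (\int[mu]_(t in `[0%R, T]) (mean_cost kappa p mixed_control mixed_mass t)%:E +
   (e * ((2 * s ^+ 2 * (1 - 2 * e) - kappa / 2) *
      \int[mu]_(r in `[0%R, T]) (2 * p r - 1) ^+ 2
       - (s + (4 * s ^+ 2 + kappa / 2) / (2 * s))))%R%:E <=
   \int[mu]_(t in `[0%R, T]) (mean_cost kappa p alpha p t)%:E)%E.
Proof.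
move=> T0.
have mF := mean_cost_measurable alpha_adm T0 (p_meas T0).
have mG := mean_cost_measurable mixed_control_admissible T0 (mixed_mass_measurable T0).
have F0 t : `[0, T]%classic t -> 0 <= mean_cost kappa p alpha p t.
  by rewrite /= in_itv/= => /andP[t0 _]; apply: mean_cost_ge0 => //; exact: p01.
have G0 t : `[0, T]%classic t -> 0 <= mean_cost kappa p mixed_control mixed_mass t.
  by rewrite /= in_itv/= => /andP[t0 _]; apply: mean_cost_ge0 => //; exact: mixed_mass01.
have [->|Foo] := eqVneq (\int[mu]_(t in `[0%R, T]) (mean_cost kappa p alpha p t)%:E)%E +oo%E.
  by rewrite leey.
have Fi : mu.-integrable `[0, T] (EFin \o mean_cost kappa p alpha p).
  apply/integrableP; split; first exact/measurable_EFinP.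
  rewrite ltey; apply: contra_neq Foo => <-.
  by apply: eq_integral => t; rewrite inE => /F0 ?; rewrite /= ger0_norm.
have Li := gain_integrable T0.
have FG t : `[0, T]%classic t ->
    mean_cost kappa p mixed_control mixed_mass t + gain t <= mean_cost kappa p alpha p t.
  by rewrite /= in_itv/= => /andP[t0 _]; exact: mean_cost_gain_pointwise.
have Gi : mu.-integrable `[0, T] (EFin \o mean_cost kappa p mixed_control mixed_mass).
  apply: (le_integrable _ _ _ (integrable_sub Fi Li)) => //.
    exact/measurable_EFinP.
  move=> t tT; rewrite /= lee_fin ger0_norm ?G0//.
  have := FG t tT; have := ler_norm (mean_cost kappa p alpha p t - gain t); lra.
rewrite -(fineK (integrable_fin_num _ Gi))// -(fineK (integrable_fin_num _ Fi))//.
rewrite -EFinD lee_fin.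
apply: (@le_trans _ _ (\int[mu]_(t in `[0, T])
   (mean_cost kappa p mixed_control mixed_mass t + gain t))).
  by rewrite RintegralD// lerD2l; exact: gain_integral_ge.
apply: le_Rintegral => //.
exact: (integrable_add Gi Li).
Qed.

End perturbation.

(** * The law and the expected cost of a controlled chain *)

Section chain_law.
Context {R : realType} {d : measure_display} {Omega : measurableType d}
  {P : probability Omega R}.
Local Notation mu := (@lebesgue_measure R).
Implicit Types (Y : R -> {RV P >-> bool}) (t T : R) (w : Omega) (b : bool).

Definition graph_at Y b : set (Omega * measurableTypeR R) :=
  [set z | 0 <= z.2 /\ Y z.2 z.1 = b].

Lemma state_measurable Y t b : measurable (Y t @^-1` [set b]).
Proof. by rewrite -[X in measurable X]setTI; exact: measurable_funP. Qed.

(** The point of the grid of mesh [1 / n.+1] that lies strictly to the right of [t] and is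
    nearest to it. *)
Definition grid (n : nat) t : R := (Num.truncn (t * n.+1%:R)).+1%:R / n.+1%:R.

Lemma graph_at_grid_measurable Y b (n : nat) :
  measurable [set z : Omega * measurableTypeR R | 0 <= z.2 /\ Y (grid n z.2) z.1 = b].
Proof.
have n0 : (0 : R) < n.+1%:R by rewrite ltr0n.
rewrite (_ : [set z | _] = \bigcup_k ((Y (k.+1%:R / n.+1%:R) @^-1` [set b]) `*`
   `[k%:R / n.+1%:R, k.+1%:R / n.+1%:R[%classic)).
  by apply: bigcupT_measurable => k; apply: measurableX => //; exact: state_measurable.
apply/seteqP; split => -[w t] /=.
  move=> [t0 Yb]; exists (Num.truncn (t * n.+1%:R)) => //.
  have /andP[h1 h2] := truncn_itv (mulr_ge0 t0 (ltW n0)).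
  by split => //=; rewrite in_itv/= ler_pdivrMr// h1 ltr_pdivlMr.
move=> [k _ [/= Yb]]; rewrite in_itv/= ler_pdivrMr// ltr_pdivlMr// => /andP[h1 h2].
have t0 : 0 <= t by rewrite -(pmulr_lge0 _ n0) (le_trans _ h1).
by split=> //; rewrite /grid (truncn_def (_ : k%:R <= _ < _)) ?h1.
Qed.

Lemma grid_gt n t : 0 <= t -> t < grid n t <= t + n.+1%:R^-1.
Proof.
move=> t0; have n0 : (0 : R) < n.+1%:R by rewrite ltr0n.
have /andP[h1 h2] := truncn_itv (mulr_ge0 t0 (ltW n0)).
rewrite /grid ltr_pdivlMr// h2 ler_pdivrMr// mulrDl mulVf ?gt_eqF//.
by rewrite -natr1 lerD2r.
Qed.

Lemma cadlag_grid Y w t : cadlag Y -> 0 <= t ->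
  exists N, forall n, (N <= n)%N -> Y (grid n t) w = Y t w.
Proof.
move=> /(_ w) [rc _] /[dup] t0 /rc [e /= e0 He].
exists (Num.truncn e^-1) => n Nn; have /andP[g1 g2] := grid_gt n t0.
apply: He => //=; rewrite distrC gtr0_norm ?subr_gt0//.
rewrite ltrBlDl (le_lt_trans g2)// ltrD2l invf_plt ?posrE//.
by apply: lt_le_trans (truncnS_gt _) _; rewrite ler_nat.
Qed.

(** Joint measurability of a right-continuous chain: as the state space is discrete, the
    state at [grid n t] is eventually the state at [t]. *)
Lemma graph_at_measurable Y b : cadlag Y -> measurable (graph_at Y b).
Proof.
move=> cY.
pose G n := [set z : Omega * measurableTypeR R | 0 <= z.2 /\ Y (grid n z.2) z.1 = b].
rewrite (_ : graph_at Y b = \bigcup_N \bigcap_(n in [set n | (N <= n)%N]) G n).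
  apply: bigcupT_measurable => N; apply: bigcap_measurable => [|n _].
    by exists N => /=.
  exact: graph_at_grid_measurable.
apply/seteqP; split => -[w t] /=.
  move=> [/= t0 Yb]; have [N HN] := cadlag_grid w cY t0.
  by exists N => // n /= Nn; split => //=; rewrite HN.
move=> [N _ H]; have [/= t0 _] := H N (leqnn N).
have [M HM] := cadlag_grid w cY t0.
split=> //=; rewrite -(HM (maxn N M)) ?leq_maxr//.
by have [] := H (maxn N M) (leq_maxl _ _).
Qed.

Lemma ysection_graph Y b t : 0 <= t -> ysection (graph_at Y b) t = Y t @^-1` [set b].
Proof.
move=> t0; apply/seteqP; split=> w; rewrite /ysection /graph_at/= inE/=.
  by case.
by [].
Qed.

Definition mass Y t : R := fine (P (Y t @^-1` [set true])).

Lemma prob_stateE Y t b : P (Y t @^-1` [set b]) = (occupation (mass Y t) b)%:E.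
Proof.
have fT : P (Y t @^-1` [set true]) \is a fin_num.
  by rewrite fin_num_measure//; exact: state_measurable.
case: b; rewrite /occupation; first by rewrite /mass fineK.
rewrite (_ : Y t @^-1` [set false] = ~` (Y t @^-1` [set true])); last first.
  by apply/seteqP; split=> w /=; case: (Y t w).
rewrite probability_setC; last exact: state_measurable.
by rewrite EFinB /mass fineK.
Qed.

Lemma mass01 Y t : 0 <= mass Y t <= 1.
Proof.
have mY := state_measurable Y t true.
rewrite /mass fine_ge0 ?measure_ge0//= -lee_fin fineK ?fin_num_measure//.
exact: probability_le1.
Qed.

Lemma mass_measurable Y T : cadlag Y -> measurable_fun `[0, T] (mass Y).
Proof.
move=> cY.
have m1 : measurable_fun [set: measurableTypeR R] (P \o ysection (graph_at Y true)).
  by apply: measurable_fun_ysection; exact: graph_at_measurable.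
apply: (eq_measurable_fun (fine \o (P \o ysection (graph_at Y true)))).
  by move=> t; rewrite inE/= in_itv/= => /andP[t0 _]; rewrite ysection_graph.
apply: measurable_funTS; apply: (@measurableT_comp _ _ _ _ _ _ (@fine R)) => //.
Qed.

(** Tonelli's theorem.  The integrand is split according to the state because
    [alpha] is measurable in time only for each fixed state, and it is extended by 0
    outside of [[0, T]] because right continuity gives joint measurability only at
    times [t >= 0]. *)
Lemma expected_cost Y (kappa : R) (p : R -> R) (alpha : R -> bool -> R) T :
  cadlag Y -> admissible alpha -> 0 <= kappa -> 0 <= T ->
  measurable_fun `[0, T] p -> (forall t, 0 <= t -> 0 <= p t <= 1) ->
  (\int[P]_w \int[mu]_(t in `[0%R, T])
     (2^-1 * alpha t (Y t w) ^+ 2 + kappa * running_cost (Y t w) (p t))%R%:E =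
   \int[mu]_(t in `[0%R, T]) (mean_cost kappa p alpha (mass Y) t)%:E)%E.
Proof.
move=> cY aa k0 T0 mp p01.
pose u b t := 2^-1 * alpha t b ^+ 2 + kappa * running_cost b (p t).
pose g b := (u b) \_ `[0, T].
have u0 b t : 0 <= t -> 0 <= u b t.
  move=> t0; have /andP[p0 p1] := p01 t t0.
  rewrite /u addr_ge0// mulr_ge0 ?sqr_ge0//.
  by case: b => //=; rewrite subr_ge0.
have mu_ b : measurable_fun `[0, T] (u b).
  apply: measurable_funD; apply: measurable_funM => //.
    apply: measurable_funX; apply/measurable_EFinP.
    by case: aa => _ ai; exact: measurable_int (ai T b T0).
  by case: b => //=; exact: measurable_funB.
have mg b : measurable_fun [set: measurableTypeR R] (g b).
  by apply/(measurable_restrictT (u b) _) => //; exact: mu_.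
have gE b t : `[0, T]%classic t -> g b t = u b t.
  by move=> tT; rewrite /g patchE ifT// inE.
have g0 b t : 0 <= g b t.
  rewrite /g patchE; case: ifPn => //; rewrite inE/= in_itv/= => /andP[t0 _].
  exact: u0.
pose F (z : Omega * measurableTypeR R) : \bar R :=
  (g true z.2 * \1_(graph_at Y true) z + g false z.2 * \1_(graph_at Y false) z)%:E.
have FE w t : 0 <= t -> F (w, t) = (g (Y t w) t)%:E.
  have ind b : 0 <= t -> \1_(graph_at Y b) (w, t) = (Y t w == b)%:R :> R.
    move=> t0; rewrite indicE; congr ((nat_of_bool _)%:R).
    by apply/idP/eqP; rewrite inE /graph_at//=; case.
  by move=> t0; rewrite /F /= !ind//; case: (Y t w); rewrite !(mulr1, mulr0) ?addr0 ?add0r.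
have mF : measurable_fun [set: Omega * measurableTypeR R] F.
  apply/measurable_EFinP; apply: measurable_funD; apply: measurable_funM.
  - by apply: (measurableT_comp (mg true)); exact: measurable_snd.
  - by apply: measurable_indic; exact: graph_at_measurable.
  - by apply: (measurableT_comp (mg false)); exact: measurable_snd.
  - by apply: measurable_indic; exact: graph_at_measurable.
have F0 z : (0 <= F z)%E by rewrite lee_fin addr_ge0// mulr_ge0.
transitivity (\int[P]_w \int[mu]_t F (w, t))%E.
  apply: eq_integral => w _; rewrite integral_mkcond; apply: eq_integral => t _.
  rewrite patchE; case: ifPn => [|tT].
    rewrite inE => tT; rewrite FE; last by move: tT; rewrite /= in_itv/= => /andP[].
    by rewrite gE.
  have g00 b : g b t = 0 by rewrite /g patchE (negbTE tT).
  by rewrite /F /= !g00 !mul0r addr0.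
rewrite (@fubini_tonelli _ _ _ _ _ P mu F)// [RHS]integral_mkcond; apply: eq_integral => t _.
rewrite patchE; case: ifPn => [|tT]; last first.
  have g00 b : g b t = 0 by rewrite /g patchE (negbTE tT).
  by apply: integral0_eq => w _; rewrite /F /= !g00 !mul0r addr0.
rewrite inE => tT.
have t0 : 0 <= t by move: tT; rewrite /= in_itv/= => /andP[].
have ind b w : \1_(graph_at Y b) (w, t) = \1_(Y t @^-1` [set b]) w :> R.
  rewrite !indicE; congr ((nat_of_bool _)%:R); apply/idP/idP; rewrite !inE /graph_at/=; last by [].
  by case.
transitivity (\int[P]_w ((u true t)%:E * (\1_(Y t @^-1` [set true]) w)%:E +
    (u false t)%:E * (\1_(Y t @^-1` [set false]) w)%:E))%E.
  by apply: eq_integral => w _; rewrite /F /= !ind !gE// EFinD !EFinM.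
have mi b : measurable_fun [set: Omega] (fun w => (\1_(Y t @^-1` [set b]) w)%:E : \bar R).
  by apply/measurable_EFinP; apply: measurable_indic; exact: state_measurable.
rewrite ge0_integralD//; last 4 first.
- by move=> w _; rewrite mule_ge0// lee_fin u0.
- by apply: measurable_funeM.
- by move=> w _; rewrite mule_ge0// lee_fin u0.
- by apply: measurable_funeM.
rewrite !ge0_integralZl_EFin ?u0//.
rewrite !integral_indic ?setIT//; try exact: state_measurable.
transitivity ((u true t)%:E * (occupation (mass Y t) true)%:E +
    (u false t)%:E * (occupation (mass Y t) false)%:E)%E.
  by congr (_ * _ + _ * _)%E; exact: prob_stateE.
rewrite -!EFinM -EFinD; congr (_%:E).
by rewrite /u /mean_cost /occupation /=; ring.
Qed.

Lemma jointE0 Y t y : joint Y 0 true t y + joint Y 0 false t y = occupation (mass Y t) y.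
Proof.
have m b s := state_measurable Y s b.
apply: EFin_inj; rewrite -prob_stateE /joint EFinD !fineK; last 2 first.
- by rewrite fin_num_measure//; apply: measurableI.
- by rewrite fin_num_measure//; apply: measurableI.
rewrite -measureU; [|by apply: measurableI..|]; last first.
  by apply/seteqP; split => // w /= [[-> _] []].
rewrite -setIUl; congr (P _); apply/seteqP; split=> w /=; first by case.
by case: (Y 0 w) => ?; split=> //; [left|right].
Qed.

Lemma joint01 Y x t y : 0 <= joint Y 0 x t y <= 1.
Proof.
have mA : measurable (Y 0 @^-1` [set x] `&` Y t @^-1` [set y]).
  by apply: measurableI; exact: state_measurable.
rewrite /joint fine_ge0 ?measure_ge0//= -lee_fin fineK ?fin_num_measure//.
exact: probability_le1.
Qed.

Lemma joint_measurable Y x y T : cadlag Y ->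
  measurable_fun `[0, T] (fun t => joint Y 0 x t y).
Proof.
move=> cY.
pose A := (Y 0 @^-1` [set x] `*` [set: measurableTypeR R]) `&` graph_at Y y.
have mA : measurable A.
  apply: measurableI; last exact: graph_at_measurable.
  by apply: measurableX => //; exact: state_measurable.
have m1 : measurable_fun [set: measurableTypeR R] (P \o ysection A).
  exact: measurable_fun_ysection.
apply: (eq_measurable_fun (fine \o (P \o ysection A))).
  move=> t; rewrite inE/= in_itv/= => /andP[t0 _]; rewrite /joint.
  congr (fine (P _)); apply/seteqP; split=> w; rewrite /ysection /A /graph_at/= inE/=.
    by move=> [[-> _] [_ ->]].
  by move=> [-> ->].
apply: measurable_funTS; apply: (@measurableT_comp _ _ _ _ _ _ (@fine R)) => //.
Qed.

(** The forward equation of the mass is the sum over the initial state of the forward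
    equations of the joint laws at the times [0] and [t]. *)
Lemma mass_primitive (sigma : R) (alpha : R -> bool -> R) (p0 : R) Y T :
  admissible alpha -> jump_chain (jump_rate sigma alpha) p0 Y ->
  primitive_on T (drift (jump_rate sigma alpha ^~ false) (jump_rate sigma alpha ^~ true)
    (mass Y)) (mass Y).
Proof.
move=> aa [cY _ rY _] t /andP[t0 _].
have E x := rY 0 t x true (lexx 0) t0.
rewrite /= in E.
have ri y : mu.-integrable `[0, t] (EFin \o (jump_rate sigma alpha ^~ y)).
  apply: (@integrable_add _ t (fun=> sigma ^+ 2) (alpha ^~ y)).
    by apply: (bounded_integrable_itv (M := `|sigma ^+ 2|)).
  by case: aa => _; apply.
have rji x y : mu.-integrable `[0, t]
    (EFin \o (fun r => jump_rate sigma alpha r y * joint Y 0 x r y)).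
  apply: (integrable_mul_bounded (M := 1)) => //; first exact: joint_measurable.
  by move=> r _; have /andP[j0 j1] := joint01 Y x r y; rewrite ger0_norm.
have -> : mass Y t = joint Y 0 true t true + joint Y 0 false t true by rewrite jointE0.
have -> : mass Y 0 = joint Y 0 true 0 true + joint Y 0 false 0 true by rewrite jointE0.
rewrite !E addrACA; congr (_ + _).
rewrite -RintegralD//; last 2 first.
- exact: integrable_sub.
- exact: integrable_sub.
apply: eq_Rintegral => r _.
have /= := jointE0 Y r true; have /= := jointE0 Y r false => e0 e1.
by rewrite /drift -e0 -e1; ring.
Qed.

Lemma mass_init sigma (alpha : R -> bool -> R) (p0 : R) Y :
  jump_chain (jump_rate sigma alpha) p0 Y -> mass Y 0 = p0.
Proof. by move=> [_ _ _ Y0]; rewrite /mass Y0. Qed.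

End chain_law.

(** * Upper limits at infinity *)

Section limsup.
Context {R : realType}.
Implicit Types (f : R -> \bar R) (c : \bar R) (M T : R).

Lemma limf_esupy_le f c M : (forall T, M < T -> (f T <= c)%E) ->
  (limf_esup f +oo%R <= c)%E.
Proof.
move=> fc; rewrite limf_esupE.
apply: (@le_trans _ _ (ereal_sup (f @` `]M, +oo[))).
  apply: ereal_inf_lbound; exists `]M, +oo[%classic => //.
  exists M; split; first exact: num_real.
  by move=> x Mx; rewrite /= in_itv/= Mx.
by apply: ge_ereal_sup => _ [T /= + <-]; rewrite in_itv/= andbT => /fc.
Qed.

Lemma limf_esupy_ge f c M : (forall T, M < T -> (c <= f T)%E) ->
  (c <= limf_esup f +oo%R)%E.
Proof.
move=> fc; rewrite limf_esupE; apply: le_ereal_inf_tmp => _ [V [N [_ NV]] <-].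
have N1 : N < Num.max M N + 1 by rewrite ltr_pwDr// le_max lexx orbT.
have M1 : M < Num.max M N + 1 by rewrite ltr_pwDr// le_max lexx.
apply: le_ereal_sup_tmp; exists (f (Num.max M N + 1)); last exact: fc.
by exists (Num.max M N + 1) => //; exact: NV.
Qed.

Lemma limf_esupy_lt f c : (limf_esup f +oo%R < c)%E ->
  exists M, forall T, M < T -> (f T < c)%E.
Proof.
rewrite limf_esupE => /ereal_inf_lt [_ [V [N [_ NV]] <-] Vc].
exists N => T NT; apply: le_lt_trans Vc; apply: ereal_sup_ubound.
by exists T => //; exact: NV.
Qed.

(** An eventual gap between two functions is inherited by their upper limits only when
    these are finite, whence the two bounds on the upper limit of [f]. *)
Lemma limf_esupy_gap f g (eta M : R) : 0 < eta ->
  (0 <= limf_esup f +oo%R)%E -> (limf_esup f +oo%R < +oo)%E ->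
  (forall T, M < T -> (g T + eta%:E <= f T)%E) ->
  (limf_esup g +oo%R < limf_esup f +oo%R)%E.
Proof.
move=> eta0 f0 foo fg.
have ffin : limf_esup f +oo%R \is a fin_num by rewrite ge0_fin_numE.
set a := fine (limf_esup f +oo%R).
have aE : limf_esup f +oo%R = a%:E by rewrite fineK.
have [N fN] : exists N, forall T, N < T -> (f T < (a + eta / 2)%:E)%E.
  by apply: limf_esupy_lt; rewrite aE lte_fin ltrDl divr_gt0.
apply: (@le_lt_trans _ _ (a - eta / 2)%:E); last first.
  by rewrite aE lte_fin ltrBlDr ltrDl divr_gt0.
apply: (@limf_esupy_le _ _ (Num.max M N)) => T; rewrite gt_max => /andP[MT NT].
have -> : (a - eta / 2)%:E = ((a + eta / 2)%:E - eta%:E)%E.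
  by rewrite -EFinB; congr (_%:E); field.
by rewrite leeBrDr//; apply: (le_trans (fg T MT)); exact/ltW/fN.
Qed.

End limsup.

(** * Equilibria *)

Lemma mixing_weight_le_half (R : realType) (k x : R) : 0 < k -> 0 < x ->
  (4 * x - k) / (16 * x) <= 1 / 2.
Proof. by move=> k0 x0; rewrite ler_pdivrMr ?mulr_gt0//; lra. Qed.

Section main.
Context {R : realType} {d : measure_display} {Omega : measurableType d}
  {P : probability Omega R}.
Local Notation mu := (@lebesgue_measure R).
Context (sigma kappa : R) (X : (R -> bool -> R) -> R -> R -> {RV P >-> bool}).
Context (sigma_gt0 : 0 < sigma) (kappa_gt0 : 0 < kappa)
    (X_chains : controlled_chains sigma X)
    (kappa_lt : kappa < critical_coupling sigma).

(** The time average in the definition of the ergodic cost, in terms of the law [m]. *)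
Let avg (p : R -> R) (alpha : R -> bool -> R) (m : R -> R) (T : R) :=
  ((T^-1)%R%:E * \int[mu]_(t in `[0%R, T]) (mean_cost kappa p alpha m t)%:E)%E.

Lemma average_costE (p : R -> R) (alpha : R -> bool -> R) (p0 T : R) :
  (forall T : R, 0 <= T -> measurable_fun `[0, T] p) ->
  (forall t, 0 <= t -> 0 <= p t <= 1) -> admissible alpha -> 0 <= p0 <= 1 ->
  0 <= T ->
  ((T^-1)%R%:E * \int[P]_w \int[mu]_(t in `[0%R, T])
     (2^-1 * alpha t (X alpha p0 t w) ^+ 2 +
      kappa * running_cost (X alpha p0 t w) (p t))%R%:E)%E =
  avg p alpha (mass (X alpha p0)) T.
Proof.
move=> mp p01 aa p00 T0; have [cY _ _ _] := X_chains aa p00.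
by rewrite (expected_cost cY aa (ltW kappa_gt0) T0 (mp T T0) p01).
Qed.

Lemma avg_le (p : R -> R) alpha (m : R -> R) (c T : R) :
  (forall T : R, 0 <= T -> measurable_fun `[0, T] p) ->
  (forall t, 0 <= t -> 0 <= p t <= 1) -> admissible alpha ->
  measurable_fun `[0, T] m -> (forall t, 0 <= t -> 0 <= m t <= 1) -> 0 < T ->
  (forall t, 0 <= t -> mean_cost kappa p alpha m t <= c) ->
  (avg p alpha m T <= c%:E)%E.
Proof.
move=> mp p01 aa mm m01 T0 H.
rewrite /avg lee_pdivrMl//.
have -> : (T%:E * c%:E = \int[mu]_(t in `[0%R, T]) (cst c%:E t))%E.
  by rewrite integral_cst//= lebesgue_measure_itv/= lte_fin T0 -EFinB subr0 muleC.
apply: ge0_le_integral => //.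
- move=> t; rewrite /= in_itv/= => /andP[t0 _]; rewrite lee_fin.
  by apply: mean_cost_ge0 => //; [exact: ltW|exact: m01].
- by apply/measurable_EFinP; apply: mean_cost_measurable => //; exact: ltW.
- by move=> t; rewrite /= in_itv/= => /andP[t0 _]; rewrite lee_fin H.
Qed.

Lemma avg_ge (p : R -> R) alpha (m : R -> R) (c T : R) :
  (forall T : R, 0 <= T -> measurable_fun `[0, T] p) ->
  (forall t, 0 <= t -> 0 <= p t <= 1) -> admissible alpha ->
  measurable_fun `[0, T] m -> 0 <= c -> 0 < T ->
  (forall t, 0 <= t -> c <= mean_cost kappa p alpha m t) ->
  (c%:E <= avg p alpha m T)%E.
Proof.
move=> mp p01 aa mm c0 T0 H.
rewrite /avg lee_pdivlMl//.
have -> : (T%:E * c%:E = \int[mu]_(t in `[0%R, T]) (cst c%:E t))%E.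
  by rewrite integral_cst//= lebesgue_measure_itv/= lte_fin T0 -EFinB subr0 muleC.
apply: ge0_le_integral => //.
- by apply/measurable_EFinP; apply: mean_cost_measurable => //; exact: ltW.
- by move=> t; rewrite /= in_itv/= => /andP[t0 _]; rewrite lee_fin H.
Qed.


Let s := sigma ^+ 2.
Let s_gt0 : 0 < s. Proof. by rewrite exprn_gt0. Qed.

Lemma mass_unique (alpha : R -> bool -> R) (p0 : R) (m : R -> R) :
  admissible alpha -> 0 <= p0 <= 1 -> m 0 = p0 ->
  (forall T : R, 0 <= T -> measurable_fun `[0, T] m) ->
  (forall t, 0 <= t -> 0 <= m t <= 1) ->
  (forall T, primitive_on T (drift (fun t => s + alpha t false)
     (fun t => s + alpha t true) m) m) ->
  forall t, 0 <= t -> mass (X alpha p0) t = m t.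
Proof.
move=> aa p00 m0 mm m01 mE t t0; have XA := X_chains aa p00.
have [cX _ _ _] := XA.
have r0 x r : 0 <= r <= t -> 0 <= s + alpha r x.
  by move=> /andP[r0 _]; rewrite addr_ge0 ?(ltW s_gt0)//; case: aa => + _; apply.
apply: (drift_unique t0 (r0 false) (r0 true)).
- exact: rate_integrable.
- exact: rate_integrable.
- exact: mass_measurable.
- by move=> r _; exact: mass01.
- exact: mm.
- by move=> r /andP[r0' _]; exact: m01.
- exact: mass_primitive XA.
- exact: mE.
- by rewrite (mass_init XA) m0.
Qed.

Lemma zero_control_admissible : admissible (fun (_ : R) (_ : bool) => 0 : R).
Proof.
split=> // T x T0; apply: (bounded_integrable_itv (M := 0)) => // r _.
by rewrite normr0.
Qed.

(** Against the flow [1 / 2] the mean cost is [kappa / 2] plus the control cost. *)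
Lemma uniform_nash : ergodic_nash kappa X (fun=> 2^-1).
Proof.
have h01 : 0 <= (2^-1 : R) <= 1 by apply/andP; split; lra.
have mh (T : R) : 0 <= T -> measurable_fun `[0, T] (fun=> 2^-1 : R) by [].
have h01' (t : R) : 0 <= t -> 0 <= (fun=> 2^-1 : R) t <= 1 by [].
have aa0 := zero_control_admissible.
have costE beta m t : mean_cost kappa (fun=> 2^-1) beta m t =
  kappa / 2 + 2^-1 * (beta t false ^+ 2 * (1 - m t) + beta t true ^+ 2 * m t).
  by rewrite /mean_cost /occupation; field.
split; [exact: h01'|by right; exists 2^-1|].
exists (fun _ _ => 0); split; [exact: aa0| |]; last first.
  move=> t t0; rewrite prob_stateE /occupation.
  rewrite (mass_unique (m := fun=> 2^-1) aa0 h01 _ _ h01')//.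
  move=> T u _; rewrite -[LHS]addr0; congr (_ + _).
  rewrite (@eq_Rintegral _ _ _ mu _ (cst 0)) ?Rintegral_cst ?mul0r// => r _.
  by rewrite /drift /=; field.
move=> beta ab; rewrite /ergodic_cost.
apply: (@le_trans _ _ (kappa / 2)%:E).
  apply: (@limf_esupy_le _ _ _ 0) => T T0; rewrite average_costE ?(ltW T0)//.
  have [c0 _ _ _] := X_chains aa0 h01.
  apply: avg_le => //; [exact: mass_measurable|by move=> *; exact: mass01|].
  by move=> t _; rewrite costE expr0n /= !mul0r addr0 mulr0 addr0.
apply: (@limf_esupy_ge _ _ _ 0) => T T0; rewrite average_costE ?(ltW T0)//.
have [cb _ _ _] := X_chains ab h01.
apply: avg_ge => //; [exact: mass_measurable|by rewrite divr_ge0// ltW|].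
move=> t t0; rewrite costE lerDl.
have /andP[m0 m1] := mass01 (X beta 2^-1) t.
by rewrite mulr_ge0// addr_ge0// mulr_ge0 ?sqr_ge0// subr_ge0.
Qed.

(** If [q t0 != 0], the optimal control is beaten by [mixed_control]: the averaged costs
    differ by at least [eta] for large [T].  The zero control shows that the optimal
    cost is finite, so that the gap survives in the upper limits. *)
Lemma nash_unique p : ergodic_nash kappa X p -> forall t, 0 <= t -> p t = 2^-1.
Proof.
move=> [p01 per [alpha [aa opt pX]]] t0 t00.
have p00 : 0 <= p 0 <= 1 := p01 0 (lexx 0).
have XA := X_chains aa p00; have [cX _ _ _] := XA.
have mp t : 0 <= t -> mass (X alpha (p 0)) t = p t by move=> t1; rewrite /mass pX.
have p_meas (T : R) : 0 <= T -> measurable_fun `[0, T] p.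
  move=> T0; apply: (eq_measurable_fun (mass (X alpha (p 0)))).
    by move=> t; rewrite inE/= in_itv/= => /andP[? _]; rewrite mp.
  exact: mass_measurable.
have pE T : primitive_on T
   (drift (fun t => s + alpha t false) (fun t => s + alpha t true) p) p.
  move=> t tT; have /andP[t1 _] := tT.
  rewrite -mp// (mass_primitive aa XA tT) mp//; congr (_ + _).
  apply: eq_Rintegral => r; rewrite inE/= in_itv/= => /andP[r0 _].
  by rewrite /drift mp.
have [tau tau0 ptau] : exists2 tau, 0 < tau & forall t, 0 <= t -> p (t + tau) = p t.
  by case: per => // -[c pc]; exists 1 => // t t1; rewrite !pc// addr_ge0.
apply: contrapT => pt0.
have qt0 : 2 * p t0 - 1 != 0.
  by apply: contra_not_neq pt0 => q0; lra.
have s2 : 0 < s ^+ 2 by rewrite exprn_gt0.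
have k4 : kappa < 4 * s ^+ 2 by move: kappa_lt; rewrite /critical_coupling /s -exprM.
(* The coefficient of q^2 in the gain, 2 s^2 (1 - 2 e) - kappa / 2, then keeps half of
   its value 2 s^2 - kappa / 2 at e = 0. *)
pose e := (4 * s ^+ 2 - kappa) / (16 * s ^+ 2).
have e0 : 0 < e by rewrite /e divr_gt0 ?mulr_gt0// subr_gt0.
have e1 : e <= 1 / 2 by exact: mixing_weight_le_half.
pose c0 := 2 * s ^+ 2 * (1 - 2 * e) - kappa / 2.
have c00 : 0 < c0.
  have -> : c0 = (4 * s ^+ 2 - kappa) / 4.
    by rewrite /c0 /e; field; rewrite ?gt_eqF.
  by rewrite divr_gt0// subr_gt0.
have fi (T : R) : 0 <= T -> mu.-integrable `[0, T] (EFin \o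
    (fun t => 2 * drift (fun t => s + alpha t false) (fun t => s + alpha t true) p t)).
  by move=> T0; apply: integrable_scale; exact: mass_drift_integrable.
have qE T : primitive_on T
    (fun t => 2 * drift (fun t => s + alpha t false) (fun t => s + alpha t true) p t)
    (fun t => 2 * p t - 1).
  move=> t tT; have /andP[t1 _] := tT.
  rewrite RintegralZl//; last exact: mass_drift_integrable.
  by rewrite {1}(pE T t tT); ring.
have qtau t : 0 <= t -> 2 * p (t + tau) - 1 = 2 * p t - 1 by move=> /ptau ->.
have [c [C [c_gt0 cC]]] := periodic_sqr_growth tau0 t00 fi qE qtau qt0.
pose C0 := s + (4 * s ^+ 2 + kappa / 2) / (2 * s).
pose beta := mixed_control s e alpha p.
have ab : admissible beta by exact: mixed_control_admissible.
have mb t : 0 <= t -> mass (X beta (p 0)) t = mixed_mass s e p t.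
  apply: mass_unique => //.
  - exact: mixed_mass0.
  - by move=> T T0; exact: mixed_mass_measurable.
  - by move=> r r0; exact: mixed_mass01.
  - by move=> T; exact: mixed_mass_primitive.
have [cb _ _ _] := X_chains ab p00.
pose eta := e * (c0 * c) / 2.
have eta0 : 0 < eta by apply: divr_gt0 => //; apply: mulr_gt0 => //; exact: mulr_gt0.
pose K := e * (c0 * C + C0).
have gap (T : R) : Num.max 0 (K / eta) < T ->
    (avg p beta (mass (X beta (p 0%R))) T + eta%:E <= avg p alpha (mass (X alpha (p 0%R))) T)%E.
  rewrite gt_max => /andP[T0 TK]; have T0' := ltW T0.
  have E1 : (\int[mu]_(t in `[0%R, T]) (mean_cost kappa p beta (mass (X beta (p 0%R))) t)%:E
     = \int[mu]_(t in `[0%R, T]) (mean_cost kappa p beta (mixed_mass s e p) t)%:E)%E.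
    apply: eq_integral => t; rewrite inE/= in_itv/= => /andP[t1 _].
    by rewrite /mean_cost mb.
  have E2 : (\int[mu]_(t in `[0%R, T]) (mean_cost kappa p alpha (mass (X alpha (p 0%R))) t)%:E
     = \int[mu]_(t in `[0%R, T]) (mean_cost kappa p alpha p t)%:E)%E.
    apply: eq_integral => t; rewrite inE/= in_itv/= => /andP[t1 _].
    by rewrite /mean_cost mp.
  rewrite /avg E1 E2 lee_pdivlMl// muleDr ?fin_num_adde_defl// muleA -EFinM.
  rewrite divff ?gt_eqF// mul1e.
  apply: le_trans (mean_cost_gain s_gt0 (ltW kappa_gt0) e0 e1 aa p_meas p01 pE T0').
  rewrite leeD2l// -EFinM lee_fin.
  have := cC T T0'; rewrite -(ler_pM2l (mulr_gt0 e0 c00)).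
  move: TK; rewrite ltr_pdivrMr// /eta /K -/c0 -/C0; lra.
have m01 (Y : R -> {RV P >-> bool}) t : 0 <= t -> 0 <= mass Y t <= 1 by move=> _; exact: mass01.
have avg0 (T : R) : 0 < T -> (0%:E <= avg p alpha (mass (X alpha (p 0%R))) T)%E.
  move=> T0; apply: avg_ge => //; first exact: mass_measurable.
  by move=> t t1; apply: mean_cost_ge0 => //; [exact: ltW|exact: m01].
have costE (a : R -> bool -> R) (aad : admissible a) (T : R) : 0 < T ->
     ((T^-1)%R%:E * \int[P]_w \int[mu]_(t in `[0%R, T])
     (2^-1 * a t (X a (p 0) t w) ^+ 2 +
      kappa * running_cost (X a (p 0) t w) (p t))%R%:E)%E =
     avg p a (mass (X a (p 0))) T.
  by move=> T0; apply: average_costE => //; exact: ltW.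
have J0 : (0 <= ergodic_cost kappa p alpha (X alpha (p 0%R)))%E.
  by apply: (@limf_esupy_ge _ _ _ 0) => T T0; rewrite costE//; exact: avg0.
have Joo : (ergodic_cost kappa p alpha (X alpha (p 0%R)) < +oo)%E.
  apply: (le_lt_trans (opt _ zero_control_admissible)).
  apply: (@le_lt_trans _ _ kappa%:E); last exact: ltry.
  have aa0 := zero_control_admissible.
  have [cX0 _ _ _] := X_chains aa0 p00.
  apply: (@limf_esupy_le _ _ _ 0) => T T0; rewrite costE//.
  apply: avg_le => //; [exact: mass_measurable|exact: m01|].
  move=> t t1; rewrite /mean_cost expr0n /= !mul0r addr0 mulr0 add0r.
  rewrite ler_piMr ?(ltW kappa_gt0)// /occupation.
  have /andP[x0 x1] := p01 t t1; have /andP[y0 y1] := mass01 (X (fun _ _ => 0) (p 0)) t.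
  nra.
have := opt beta ab; apply/negP; rewrite -ltNge.
apply: (limf_esupy_gap (M := Num.max 0 (K / eta)) eta0 J0 Joo) => T TM.
have T0 : 0 < T by move: TM; rewrite gt_max => /andP[].
by rewrite !costE//; exact: gap.
Qed.

End main.

Theorem proposition7p1 (R : realType) (d : measure_display)
    (Omega : measurableType d) (P : probability Omega R)
    (sigma kappa : R) (X : (R -> bool -> R) -> R -> R -> {RV P >-> bool})
    (sigma_gt0 : 0 < sigma) (kappa_gt0 : 0 < kappa)
    (X_chains : controlled_chains sigma X)
    (kappa_lt : kappa < critical_coupling sigma) :
  ergodic_nash kappa X (fun=> 2^-1) /\
  (forall p : R -> R, ergodic_nash kappa X p ->
    forall t, 0 <= t -> p t = 2^-1).
Proof.
split; first exact: (uniform_nash sigma_gt0 kappa_gt0 X_chains).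
exact: (nash_unique sigma_gt0 kappa_gt0 X_chains kappa_lt).
Qed.
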